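(* Let $T$ be a tournament of order at least $5$ that is not a transitive tournament of even order. Then there exists $X\in \mathrm{tr}(T)$ such that $\mathrm{Inv}(T,X)$ is indecomposable. Moreover, $\delta'(T)=\Delta(T)$.
   Context: A tournament $T=(V(T),A(T))$ is a finite vertex set with, for every two distinct vertices $x,y$, exactly one of the arcs $(x,y),(y,x)$ in $A(T)$; its order is $|V(T)|$. $T$ is transitive if $(x,y),(y,z)\in A(T)$ implies $(x,z)\in A(T)$. For $X\subseteq V(T)$, $\overline X=V(T)\setminus X$, and $\mathrm{Inv}(T,X)$ is the tournament obtained from $T$ by reversing all arcs having both endpoints in $X$. A module of $T$ is a set $M\subseteq V(T)$ such that for all $x,y\in M$ and $v\in V(T)\setminus M$, $(v,x)\in A(T)$ if and only if $(v,y)\in A(T)$. The trivial modules are $\varnothing$, the singletons $\{u\}$ ($u\in V(T)$) and $V(T)$. $T$ is indecomposable if all its modules are trivial, and decomposable otherwise. $\mathcal M(T)$ denotes the set of nontrivial modules of $T$. A co-module of $T$ is a set $M\subseteq V(T)$ such that $M$ or $\overline M$ is a nontrivial module of $T$. $\mathrm{mc}(T)$ denotes the set of co-modules of $T$ that are minimal under inclusion among all co-modules of $T$. The co-modular index $\Delta(T)$ is the maximum size of a set of pairwise disjoint co-modules of $T$ (so $\Delta(T)=0$ if $T$ is indecomposable). Two sets $E,F$ overlap if $E\cap F$, $E\setminus F$ and $F\setminus E$ are all nonempty. Let $\mathcal F$ be a finite family of finite sets. $\mathcal F$ is strictly bipartite by a (finite) set $S$ if $S$ overlaps every element of $\mathcal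 F$. A transversal of $\mathcal F$ is a (finite) set $R$ with $F\cap R\ne\varnothing$ for every $F\in\mathcal F$; it is exact if $|F\cap R|=1$ for every $F\in\mathcal F$, and minimum if it has minimum size among transversals of $\mathcal F$. $\mathrm{tr}(T)$ denotes the set of all $R$ that are both exact and minimum transversals of $\mathrm{mc}(T)$ and such that $\mathcal M(T)$ is strictly bipartite by $R$. For $T$ of order at least $5$ that is not transitive of even order, the decomposability subtournament-index $\delta'(T)$ is the smallest integer $m$ for which there exists $X\subseteq V(T)$ with $|X|=m$ such that $\mathrm{Inv}(T,X)$ is indecomposable (existence of such an $X$ follows from the first assertion). *)

(* Defs.v *)
From mathcomp Require Import all_boot.
Set Implicit Arguments.
Unset Strict Implicit.
Unset Printing Implicit Defensive.

(* The vertex set is the whole finite type V, so V(T) is [set: V] and the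
   order of T is #|V|. *)
Record tournament (V : finType) := Tournament {
  tarc :> rel V;
  tarc_irreflexive : irreflexive tarc;
  tarc_exactly_one : forall x y : V, x != y -> tarc x y (+) tarc y x
}.

Section SetFamilies.

Variable V : finType.
Implicit Types (E F R S : {set V}) (FF : {set {set V}}).

Definition overlap E F : bool :=
  [&& E :&: F != set0, E :\: F != set0 & F :\: E != set0].

Definition strictly_bipartite_by FF S : bool :=
  [forall F in FF, overlap S F].

(* Unrelated to finset's is_transversal, which concerns partitions. *)
Definition transversal_of FF R : bool :=
  [forall F in FF, F :&: R != set0].

Definition exact_transversal_of FF R : bool :=
  transversal_of FF R && [forall F in FF, #|F :&: R| == 1].

Definition minimum_transversal_of FF R : bool :=
  transversal_of FF R && [forall S, transversal_of FF S ==> (#|R| <= #|S|)].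

End SetFamilies.

Section Inversion.

Variables (V : finType) (T : tournament V) (X : {set V}).

Definition inv_arc : rel V :=
  fun x y => if (x \in X) && (y \in X) then T y x else T x y.

Lemma inv_arc_irreflexive : irreflexive inv_arc.
Proof. by move=> x; rewrite /inv_arc tarc_irreflexive if_same. Qed.

Lemma inv_arc_exactly_one (x y : V) :
  x != y -> inv_arc x y (+) inv_arc y x.
Proof.
move=> neq_xy; rewrite /inv_arc [(y \in X) && _]andbC.
by case: ifP => _; apply: tarc_exactly_one; rewrite // eq_sym.
Qed.

Definition Inv : tournament V :=
  Tournament inv_arc_irreflexive inv_arc_exactly_one.

End Inversion.

Section Modules.

Variables (V : finType) (T : tournament V).
Implicit Types M : {set V}.

Definition module M : bool :=
  [forall x in M, forall y in M, forall v in ~: M, T v x == T v y].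

Definition trivial_set M : bool :=
  [|| M == set0, [exists u, M == [set u]] | M == [set: V]].

Definition indecomposable : bool := [forall M, module M ==> trivial_set M].

Definition nontrivial_modules : {set {set V}} :=
  [set M | module M && ~~ trivial_set M].

Definition comodules : {set {set V}} :=
  [set M | (M \in nontrivial_modules) || (~: M \in nontrivial_modules)].

Definition mc : {set {set V}} := [set M | minset (mem comodules) M].

(* The co-modular index Delta(T). *)
Definition comodular_index : nat :=
  \max_(P : {set {set V}} | (P \subset comodules) && trivIset P) #|P|.

Definition tr : {set {set V}} :=
  [set R | [&& exact_transversal_of mc R,
               minimum_transversal_of mc R
             & strictly_bipartite_by nontrivial_modules R]].

End Modules.

(* The index delta'(T); it is meaningful only when some Inv T X is
   indecomposable, the default [set: V] of arg min being irrelevant then. *)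
Definition decomposability_subtournament_index
    (V : finType) (T : tournament V) : nat :=
  #|[arg min_(X < [set: V] | indecomposable (Inv T X)) #|X|]|.

(* Main.v *)
Require Import Defs.
From mathcomp Require Import all_boot.

Set Implicit Arguments.
Unset Strict Implicit.
Unset Printing Implicit Defensive.

(* A minimal co-module meets another one only if both are two-vertex modules, so
   mc(T) consists of pairwise disjoint sets and of transitive chains of
   consecutive twins. Choosing alternate vertices on each chain and one point in
   every other member gives an exact transversal X whose size is that of a
   packing of co-modules; the ends at which chains are numbered can be arranged
   so that X contains no nontrivial module, unless T is transitive of even
   order.

   Let M be a nontrivial module of Inv(T, X). Then X overlaps M; a vertex of
   X \ M separates M /\ X from M \ X in T, and a vertex outside M and X does not
   separate M. Comparing this with the minimal co-modules of the points of X
   leaves two situations, in which mc(T) has just two members: either one of them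
   is {a} with a source or sink a, and the other is its complement, or one of
   them is a two-vertex module and the other is its complement. A counting
   argument then yields another choice of two points that works.

   Conversely, if Inv(T, X) is indecomposable, then X overlaps every nontrivial
   module of T, hence meets every co-module, so |X| >= Delta(T). *)

(** * Modules and minimal co-modules *)

Section Modules.

Variables (V : finType) (T : tournament V).
Implicit Types (x y v : V) (E F G M N : {set V}).

Lemma arcC x y : x != y -> T y x = ~~ T x y.
Proof. by move=> /(tarc_exactly_one T); case: (T x y); case: (T y x). Qed.

Lemma arc_eqC v x y : v != x -> v != y -> T v x = T v y -> T x v = T y v.
Proof. by move=> vx vy e; rewrite (arcC vx) (arcC vy) e. Qed.

Lemma moduleP M :
  reflect (forall x y v, x \in M -> y \in M -> v \notin M -> T v x = T v y)
          (module T M).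
Proof.
apply: (iffP forall_inP) => [mM x y v xM yM vM | mM x xM].
  have /forall_inP/(_ _ yM)/forall_inP/(_ v) := mM _ xM.
  by rewrite inE => /(_ vM)/eqP.
apply/forall_inP => y yM; apply/forall_inP => v; rewrite inE => vM.
by apply/eqP; apply: mM.
Qed.

Lemma in_outside M x v : x \in M -> v \notin M -> v != x.
Proof. by move=> xM; apply: contraNneq => ->. Qed.

Lemma module_out M x y v :
  module T M -> x \in M -> y \in M -> v \notin M -> T x v = T y v.
Proof.
move=> /moduleP mM xM yM vM.
by apply: arc_eqC (mM _ _ _ xM yM vM); apply: in_outside vM.
Qed.

Lemma in_nontrivial M :
  (M \in nontrivial_modules T) = [&& module T M, 1 < #|M| & M != setT].
Proof.
rewrite inE /trivial_set !negb_or; case: (module T M) => //=.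
have -> : 1 < #|M| = (M != set0) && ~~ [exists u, M == [set u]].
  apply/idP/andP => [M1 | [M0 M1]].
    split; first by rewrite -card_gt0 ltnW.
    by apply/existsPn => u; apply: contraTneq M1 => ->; rewrite cards1.
  rewrite ltn_neqAle card_gt0 M0 andbT eq_sym; apply: contra M1 => /cards1P[u ->].
  by apply/existsP; exists u.
by rewrite andbA.
Qed.

Lemma indecomposableP :
  reflect (nontrivial_modules T = set0) (indecomposable T).
Proof.
apply: (iffP forallP) => [iT | T0 M].
  apply/setP => M; rewrite !inE; apply/negbTE; rewrite negb_and negbK.
  by rewrite -implybE.
have := in_set0 M; rewrite -T0 inE => /negbT.
by rewrite negb_and negbK -implybE.
Qed.

Lemma ntriv_module M : M \in nontrivial_modules T -> module T M.
Proof. by rewrite in_nontrivial => /and3P[]. Qed.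

Lemma ntriv_gt1 M : M \in nontrivial_modules T -> 1 < #|M|.
Proof. by rewrite in_nontrivial => /and3P[]. Qed.

Lemma ntrivI M x y v : module T M -> x \in M -> y \in M -> x != y ->
  v \notin M -> M \in nontrivial_modules T.
Proof.
move=> mM xM yM xy vM; rewrite in_nontrivial mM /=; apply/andP; split.
  by apply/card_gt1P; exists x, y.
by apply: contraNneq vM => ->; rewrite inE.
Qed.

Lemma moduleI M N : module T M -> module T N -> module T (M :&: N).
Proof.
move=> /moduleP mM /moduleP mN; apply/moduleP => x y v.
rewrite !inE negb_and => /andP[xM xN] /andP[yM yN] /orP[]; by [apply: mM|apply: mN].
Qed.

Lemma moduleU M N z : z \in M -> z \in N ->
  module T M -> module T N -> module T (M :|: N).
Proof.
move=> zM zN /moduleP mM /moduleP mN; apply/moduleP => x y v.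
rewrite !inE negb_or => xMN yMN /andP[vM vN].
have step t : (t \in M) || (t \in N) -> T v t = T v z.
  by case/orP => tM; [apply: mM|apply: mN].
by rewrite !step.
Qed.

(** A vertex of [M :&: N] sees [M :\: N] as [n] does, because [N] is a module, and [n] lies outside
    [M]. *)
Lemma moduleD M N n : n \in N -> n \notin M ->
  module T M -> module T N -> module T (M :\: N).
Proof.
move=> nN nM mM mN; apply/moduleP => x y v.
rewrite !inE negb_and negbK => /andP[xN xM] /andP[yN yM] vMN.
have [vM|vM] := boolP (v \in M); last by move/moduleP: mM; apply.
have vN : v \in N by move: vMN; rewrite vM orbF.
rewrite (module_out mN vN nN xN) (module_out mN vN nN yN).
by move/moduleP: mM; apply.
Qed.

Lemma comodule_ntriv M : M \in nontrivial_modules T -> M \in comodules T.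
Proof. by rewrite [M \in comodules T]inE => ->. Qed.

Lemma comoduleC M : (~: M \in comodules T) = (M \in comodules T).
Proof. by rewrite !in_set setCK orbC. Qed.

Lemma comodule_neq0 M : M \in comodules T -> exists x, x \in M.
Proof.
move=> cM; apply/set0Pn; apply: contraTneq cM => ->.
by rewrite inE !in_nontrivial cards0 setC0 eqxx /= !andbF.
Qed.

Lemma comodule_proper M : M \in comodules T -> exists x, x \notin M.
Proof.
by rewrite -comoduleC => /comodule_neq0[x]; rewrite inE; exists x.
Qed.

Lemma mc_comodule F : F \in mc T -> F \in comodules T.
Proof. by rewrite inE => /minsetP[]. Qed.

Lemma mc_min F G : F \in mc T -> G \in comodules T -> G \subset F -> G = F.
Proof. by rewrite inE => /minsetP[_ mF] cG; apply: mF. Qed.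

Lemma mc_sub G : G \in comodules T -> exists2 F, F \in mc T & F \subset G.
Proof.
by move=> /(@minset_exists _ (mem (comodules T)))[F mF FG]; exists F; rewrite ?inE.
Qed.

Lemma mc_notsub E F : E \in mc T -> F \in mc T -> E != F ->
  exists2 x, x \in E & x \notin F.
Proof.
move=> mE mF EF; apply/subsetPn; apply: contra EF => sEF.
by apply/eqP; apply: mc_min (mc_comodule mE) sEF.
Qed.

(* In the mixed case the union of E and the module V \ F would have a
   complement smaller than F, and two complements of modules cannot overlap
   either, so that only the case of two modules remains. *)
Lemma mc_overlap E F x : E \in mc T -> F \in mc T -> E != F ->
  x \in E -> x \in F -> E \in nontrivial_modules T /\ #|E| = 2.
Proof.
have mixed E' F' : E' \in mc T -> F' \in mc T -> E' != F' -> x \in E' ->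
    x \in F' -> E' \in nontrivial_modules T ->
    ~: F' \in nontrivial_modules T -> False.
  move=> mE mF EF xE xF nE nF.
  have [e eE eF] := mc_notsub mE mF EF.
  have [f fF fE] := mc_notsub mF mE (contra_neq (@esym _ _ _) EF).
  have nU : E' :|: ~: F' \in nontrivial_modules T.
    apply: (@ntrivI _ x e f); rewrite ?inE ?xE ?eE ?negb_or ?fE ?fF //.
      by apply: (@moduleU _ _ e); rewrite ?inE ?ntriv_module.
    by apply: contraNneq eF => <-.
  have sF : ~: (E' :|: ~: F') \subset F'.
    by apply/subsetP => t; rewrite !inE negb_or negbK => /andP[].
  have cU : ~: (E' :|: ~: F') \in comodules T by rewrite comoduleC comodule_ntriv.
  have /setP/(_ x) := mc_min mF cU sF.
  by rewrite !inE xE xF.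
move=> mE mF EF xE xF.
have [e eE eF] := mc_notsub mE mF EF.
have [f fF fE] := mc_notsub mF mE (contra_neq (@esym _ _ _) EF).
have := mc_comodule mE; rewrite inE => /orP[nE|nE]; last first.
  have := mc_comodule mF; rewrite inE => /orP[nF|nF].
    by case: (mixed F E); rewrite // eq_sym.
  have [/existsP[z /andP[]]|] := boolP [exists z, (z \notin E) && (z \notin F)].
    move=> zE zF; have nU : ~: E :|: ~: F \in nontrivial_modules T.
      apply: (@ntrivI _ z e x); rewrite ?inE ?xE ?xF ?zE ?eF ?orbT //.
        by apply: (@moduleU _ _ z); rewrite ?inE ?ntriv_module.
      by apply: contraNneq zE => ->.
    have sE : ~: (~: E :|: ~: F) \subset E.
      by apply/subsetP => t; rewrite !inE negb_or !negbK => /andP[].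
    have cU : ~: (~: E :|: ~: F) \in comodules T by rewrite comoduleC comodule_ntriv.
    have /setP/(_ e) := mc_min mE cU sE.
    by rewrite !inE eE eF.
  move=> /existsPn EFT; have sEF : ~: E \subset F.
    by apply/subsetP => t; rewrite inE => tE; have := EFT t; rewrite tE /= negbK.
  have /setP/(_ x) := mc_min mF (comodule_ntriv nE) sEF.
  by rewrite inE xE xF.
have := mc_comodule mF; rewrite inE => /orP[nF|nF]; last by case: (mixed E F).
split=> //; have small G g : module T G -> G \subset E -> g \in E -> g \notin G ->
    #|G| <= 1.
  move=> mG sG gE gG; rewrite leqNgt; apply/negP => G1.
  have cG : G \in comodules T.
    apply/comodule_ntriv; rewrite in_nontrivial mG G1.
    by apply: contraNneq gG => ->; rewrite inE.
  by move: gG; rewrite (mc_min mE cG sG) gE.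
have I1 : #|E :&: F| <= 1.
  by apply: (small _ e); rewrite ?subsetIl ?inE ?eE ?eF ?moduleI ?ntriv_module.
have D1 : #|E :\: F| <= 1.
  apply: (small _ x); rewrite ?subsetDl ?inE ?xF //.
  by apply: (moduleD fF); rewrite ?ntriv_module.
apply/eqP; rewrite eqn_leq (ntriv_gt1 nE) andbT -(cardsID F E).
by rewrite (leq_add I1 D1).
Qed.

(** If the two meet, [mc_overlap] applies. If not, a vertex outside [E] sees [E] as a point [w] of
    [F] does, both lying in the module [~: E]; and [w] does not separate points of [E], which lie in
    the module [~: F]. *)
Lemma mc_cotypes E F : E \in mc T -> F \in mc T -> E != F ->
  ~: E \in nontrivial_modules T -> ~: F \in nontrivial_modules T -> module T E.
Proof.
move=> mE mF EF nE nF.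
have [/existsP[z /andP[zE zF]]|/existsPn dEF] :=
    boolP [exists z, (z \in E) && (z \in F)].
  by have [/ntriv_module] := mc_overlap mE mF EF zE zF.
have [w wF] := comodule_neq0 (mc_comodule mF).
have wE : w \notin E by have := dEF w; rewrite wF andbT.
have outF z : z \in E -> z \notin F by move=> zE; have := dEF z; rewrite zE.
apply/moduleP => x y v xE yE vE.
have step z : z \in E -> T v z = T w z.
  move=> zE; apply: (module_out (ntriv_module nE)); by rewrite inE ?zE.
rewrite !step //.
by move/moduleP: (ntriv_module nF); apply; rewrite ?inE ?wF ?outF.
Qed.

Lemma singleton_comodule x :
  2 < #|V| -> (exists e, forall v, v != x -> T x v = e) ->
  [set x] \in comodules T.
Proof.
move=> V2 [e xe]; rewrite -comoduleC; apply: comodule_ntriv.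
rewrite in_nontrivial cardsC1 -ltnS prednK ?V2 /=; last exact: leq_trans V2.
apply/andP; split.
  apply/moduleP => y z v; rewrite !inE negbK => yx zx /eqP->.
  by rewrite !xe.
by apply/eqP => /setP/(_ x); rewrite !inE eqxx.
Qed.

Lemma singleton_mc x :
  [set x] \in mc T -> exists e, forall v, v != x -> T x v = e.
Proof.
move=> /mc_comodule; rewrite inE => /orP[/ntriv_gt1|nx]; first by rewrite cards1.
have /card_gt0P[y yx] := ltnW (ntriv_gt1 nx).
exists (T x y) => v vx.
by move/moduleP: (ntriv_module nx); apply; rewrite ?inE ?vx ?negbK // -in_setC1.
Qed.

Lemma mc_singleton_eq x F : [set x] \in mc T -> F \in mc T -> x \in F -> F = [set x].
Proof.
move=> mx mF xF; symmetry; apply: mc_min mF (mc_comodule mx) _.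
by rewrite sub1set.
Qed.

End Modules.

(** * Nontrivial modules of an inversion *)

(** The second clause gives every point of [X] a minimal co-module to work with; the third is the
    part of overlapping that transversality leaves open. *)
Definition tight_transversal (V : finType) (T : tournament V) (X : {set V}) :=
  [/\ forall F, F \in mc T -> exists x, F :&: X = [set x],
      forall x, x \in X -> exists2 F, F \in mc T & x \in F
    & forall N, N \in nontrivial_modules T -> ~~ (N \subset X)].

Lemma mem_setI1 (V : finType) (F X : {set V}) x y :
  F :&: X = [set x] -> y \in F -> y \in X -> y = x.
Proof. by move=> /setP/(_ y); rewrite !inE => e yF yX; apply/eqP; rewrite -e yF. Qed.

Lemma setI1_mem (V : finType) (F X : {set V}) x :
  F :&: X = [set x] -> x \in F /\ x \in X.
Proof. by move=> /setP/(_ x); rewrite !inE eqxx => /andP. Qed.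

Section ModuleOfInversion.

Variables (V : finType) (T : tournament V) (X M : {set V}).
Hypothesis V5 : 5 <= #|V|.
Hypothesis tX : tight_transversal T X.
Hypothesis nM : M \in nontrivial_modules (Inv T X).
Implicit Types (a b c d v : V) (F N : {set V}).

Let V2 : 2 < #|V|. Proof. exact: leq_trans V5. Qed.

Lemma tight_meets G : G \in comodules T -> exists2 x, x \in G & x \in X.
Proof.
case: tX => H1 _ _ /mc_sub[F mF /subsetP FG].
have [x /setI1_mem[xF xX]] := H1 _ mF.
by exists x; rewrite ?FG.
Qed.

Lemma tight_private F x : F \in mc T -> x \in F -> x \in X -> F :&: X = [set x].
Proof.
case: tX => H1 _ _ mF xF xX.
by have [y FX] := H1 _ mF; rewrite FX (mem_setI1 FX xF xX).
Qed.

(** With two points [N] would be nontrivial, hence contain a minimal co-module, which [X] meets.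
    Several sets are shown below to be singletons in this way. *)
Lemma no_module_avoiding N v : module T N -> v \notin N ->
  (forall x, x \in N -> x \notin X) -> forall x y, x \in N -> y \in N -> x = y.
Proof.
move=> mN vN NX x y xN yN; apply: contraTeq isT => xy.
have nN := ntrivI mN xN yN xy vN.
have [z zN] := tight_meets (comodule_ntriv nN).
by rewrite (negbTE (NX _ zN)).
Qed.

Let mM : module (Inv T X) M := ntriv_module nM.

Lemma arc_out v x y : x \in M -> y \in M -> v \notin M -> v \notin X ->
  T v x = T v y.
Proof.
move=> xM yM vM vX; move/moduleP: mM => /(_ x y v xM yM vM).
by rewrite /= /inv_arc (negbTE vX).
Qed.

(** The inversion reverses the arc between [v] and [a] and keeps the one between [v] and [b]. *)
Lemma arc_split v a b : a \in M -> b \in M -> v \notin M -> v \in X ->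
  a \in X -> b \notin X -> T v b = ~~ T v a.
Proof.
move=> aM bM vM vX aX bX; move/moduleP: mM => /(_ a b v aM bM vM).
rewrite /= /inv_arc vX aX (negbTE bX) /= => <-.
by rewrite (@arcC _ T v a) // (in_outside aM vM).
Qed.

(** If [X] did not overlap [M], then [M] would be a nontrivial module of [T] as well; but [X] meets
    each of those and its complement, and contains none of them. *)
Lemma module_unmixed : (exists2 v, v \in M & v \in X) /\
  (exists2 v, v \in M & v \notin X) /\ (exists2 v, v \notin M & v \in X).
Proof.
have nT : module T M -> M \in nontrivial_modules T.
  by move: nM; rewrite !in_nontrivial => /andP[_ ->] ->.
have [a aM aX] : exists2 v, v \in M & v \in X.
  apply/exists_inP; apply: contraT => /exists_inPn MX.
  have /nT/comodule_ntriv/tight_meets[x xM] : module T M.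
    apply/moduleP => x y v xM yM vM; move/moduleP: mM => /(_ x y v xM yM vM).
    by rewrite /= /inv_arc (negbTE (MX _ xM)) (negbTE (MX _ yM)) andbF.
  by rewrite (negbTE (MX _ xM)).
split; first by exists a.
split.
  apply/exists_inP; apply: contraT => /exists_inPn MX.
  have sMX x : x \in M -> x \in X by move/MX; rewrite negbK.
  have /nT nT' : module T M.
    apply/moduleP => x y v xM yM vM; move/moduleP: mM => /(_ x y v xM yM vM).
    rewrite /= /inv_arc (sMX _ xM) (sMX _ yM) !andbT.
    by case: ifP => // _ e; rewrite (@arcC _ T x v) 1?(@arcC _ T y v) ?e //;
      by rewrite eq_sym (in_outside _ vM).
  by case: tX => _ _ /(_ _ nT')/subsetPn[x /sMX->].
apply/exists_inP; apply: contraT => /exists_inPn MX.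
have /nT/comodule_ntriv : module T M.
  apply/moduleP => x y v xM yM vM; move/moduleP: mM => /(_ x y v xM yM vM).
  by rewrite /= /inv_arc (negbTE (MX _ vM)).
rewrite -comoduleC => /tight_meets[x]; rewrite inE => xM.
by rewrite (negbTE (MX _ xM)).
Qed.

(** For [a] in [M]: a source or a sink of the subtournament induced on [M]. *)
Definition extreme a := exists e, forall m, m \in M -> m != a -> T a m = e.

(** A point of [X] outside [M] separates [a] from [M :\: X], so the module [F] meets [M] in [a]
    alone. Any other point of [F] lies outside [M] and [X], hence sees all of [M] alike, and [a]
    sees the rest of [M] in the same way. Finally [F :\ a] is a module avoiding [X]. *)
Lemma twin_extreme a F : a \in M -> a \in X -> F \in mc T -> a \in F ->
  F \in nontrivial_modules T ->
  exists d e, [/\ d \notin M, d \notin X, F = [set a; d], T d a = e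
               & forall m, m \in M -> m != a -> T a m = e].
Proof.
move=> aM aX mF aF nF; have FX := tight_private mF aF aX.
have mF' := ntriv_module nF.
have [_ [[b bM bX] [c cM cX]]] := module_unmixed.
have ca : c != a := in_outside aM cM.
have cF : c \notin F by apply: contra_neqN ca => cF; apply: mem_setI1 FX cF cX.
have FM m : m \in M -> m \in F -> m = a.
  move=> mM' mF1; have [mX|mX] := boolP (m \in X); first exact: mem_setI1 FX mF1 mX.
  have := arc_split aM mM' cM cX aX mX.
  by move/moduleP: mF' => /(_ a m c aF mF1 cF) ->; case: (T c m).
have [d dF da] : exists2 d, d \in F & d != a.
  have /card_gt1P[x [y [xF yF xy]]] := ntriv_gt1 nF.
  by have [xa|xa] := eqVneq x a; [exists y; rewrite // -xa eq_sym|exists x].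
have FXn d' : d' \in F -> d' != a -> d' \notin X /\ d' \notin M.
  move=> dF' da'; split; apply: contra_neqN da' => h; last exact: FM.
  exact: mem_setI1 FX dF' h.
have am d' m : d' \in F -> d' != a -> m \in M -> m != a -> T a m = T d' a.
  move=> dF' da' mM' ma; have [dX dM] := FXn _ dF' da'.
  rewrite -(arc_out mM' aM dM dX); apply: module_out mF' _ _ _ => //.
  by apply: contra_neqN ma; apply: FM.
have [dX dM] := FXn _ dF da.
exists d, (T d a); split => //; last by move=> m; apply: am.
have ba : b != a by apply: contraNneq bX => ->.
apply/setP => x; rewrite !inE; apply/idP/orP => [xF|[/eqP->|/eqP->]] //.
have [xa|xa] := eqVneq x a; [by left|right].
apply/eqP; apply: (@no_module_avoiding (F :\ a) c).
- apply/moduleP => y z v; rewrite !inE => /andP[ya yF] /andP[za zF].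
  rewrite negb_and negbK => /orP[/eqP->|vF].
    rewrite (@arcC _ T y a) // (@arcC _ T z a) //.
    by rewrite -(am _ b yF) // -(am _ b zF).
  by move/moduleP: mF'; apply.
- by rewrite !inE (negbTE cF) andbF.
- by move=> y; rewrite !inE => /andP[ya yF]; have [] := FXn _ yF ya.
- by rewrite !inE xa.
- by rewrite !inE da.
Qed.

Lemma singleton_extreme a : [set a] \in mc T -> extreme a.
Proof. by move=> /singleton_mc[e ae]; exists e => m _; apply: ae. Qed.

(** * Uniqueness of points of [M] when those in [X] are extreme *)

Section AllExtreme.

Hypothesis extA : forall a, a \in M -> a \in X -> extreme a.

(** No vertex separates [M :\: X]: extreme points do not, points of [X] outside [M] see it opposite
    to [a], and other vertices see [M] alike. It is thus a module avoiding [X]. *)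
Lemma outside_point_unique b b' : b \in M -> b \notin X -> b' \in M ->
  b' \notin X -> b = b'.
Proof.
move=> bM bX bM' bX'; have [[a aM aX] [_ [c cM cX]]] := module_unmixed.
apply: (@no_module_avoiding (M :\: X) c); rewrite ?inE ?bM ?bX ?bM' ?bX' //.
- apply/moduleP => x y v; rewrite !inE => /andP[xX xM] /andP[yX yM].
  rewrite negb_and negbK => h.
  have [vM|vM] := boolP (v \in M).
    have vX : v \in X by rewrite vM orbF in h.
    have [e ve] := extA vM vX.
    by rewrite !ve //; [apply: contraNneq yX => ->|apply: contraNneq xX => ->].
  have [vX|vX] := boolP (v \in X); last exact: arc_out.
  by rewrite (arc_split aM xM vM vX aX xX) (arc_split aM yM vM vX aX yX).
- by rewrite (negbTE cM) andbF.
- by move=> x; rewrite !inE => /andP[].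
Qed.

(** Two extreme points on the same side of [b] would both be sources or both be sinks of [M], which
    the arc between them forbids. *)
Lemma inside_point_unique b a a' : b \in M -> b \notin X -> 
  a \in M -> a \in X -> a' \in M -> a' \in X -> T b a = T b a' -> a = a'.
Proof.
move=> bM bX aM aX aM' aX' baa'; apply: contraTeq isT => neq.
have [e ae] := extA aM aX; have [e' ae'] := extA aM' aX'.
have ba : b != a by apply: contraNneq bX => ->.
have ba' : b != a' by apply: contraNneq bX => ->.
have := arcC T neq; rewrite ae // 1?eq_sym // ae' // -(ae b) // -(ae' b) //.
by rewrite (arcC T ba) (arcC T ba') baa'; case: (T b a').
Qed.

End AllExtreme.

(** Otherwise a second point [d] of [F] lies outside [M] and [X] and sees [a] and [b] alike,
    although [c], in the same module, separates them. *)
Lemma outer_partner c F : c \notin M -> c \in X -> F \in mc T -> c \in F ->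
  F \in nontrivial_modules T -> exists b, [/\ b \in F, b \in M & b \notin X].
Proof.
move=> cM cX mF cF nF; have FX := tight_private mF cF cX.
have mF' := ntriv_module nF.
have [[a aM aX] [[b bM bX] _]] := module_unmixed.
have aF : a \notin F.
  by apply: contra_neqN (in_outside aM cM) => aF; rewrite (mem_setI1 FX aF).
have [bF|bF] := boolP (b \in F); first by exists b.
have [d dF dc] : exists2 d, d \in F & d != c.
  have /card_gt1P[x [y [xF yF xy]]] := ntriv_gt1 nF.
  by have [xa|xa] := eqVneq x c; [exists y; rewrite // -xa eq_sym|exists x].
have dX : d \notin X by apply: contra_neqN dc => dX; apply: mem_setI1 FX dF dX.
have [dM|dM] := boolP (d \in M); first by exists d.
have := arc_split aM bM cM cX aX bX.
rewrite (module_out mF' cF dF aF) (module_out mF' cF dF bF).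
by rewrite (arc_out aM bM dM dX); case: (T d b).
Qed.

(** By [outer_partner], [c] sees [c'] as it sees a point of [M :\: X], that is, opposite to [a];
    likewise with [c] and [c'] exchanged. *)
Lemma outer_unique a c c' F F' : a \in M -> a \in X ->
  c \notin M -> c \in X -> F \in mc T -> c \in F -> F \in nontrivial_modules T ->
  c' \notin M -> c' \in X -> F' \in mc T -> c' \in F' ->
  F' \in nontrivial_modules T -> T c a = T c' a -> c = c'.
Proof.
move=> aM aX cM cX mF cF nF cM' cX' mF' cF' nF' e; apply: contraTeq isT => neq.
have half d d' D' : d != d' -> d \notin M -> d \in X -> d' \notin M ->
    d' \in X -> D' \in mc T -> d' \in D' -> D' \in nontrivial_modules T ->
    T d d' = ~~ T d a.
  move=> dd' dM dX dM' dX' mD' dD' nD'.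
  have [b [bD' bM bX]] := outer_partner dM' dX' mD' dD' nD'.
  rewrite -(arc_split aM bM dM dX aX bX).
  move/moduleP: (ntriv_module nD'); apply=> //.
  apply: contra_neqN dd' => dD.
  exact: mem_setI1 (tight_private mD' dD' dX') dD dX.
have := arcC T neq; rewrite (half c c' F') // (half c' c F) // 1?eq_sym // e.
by case: (T c' a).
Qed.


Lemma two_points (P Q : pred V) p q : P p -> Q q ->
  (forall x, x \in X -> P x || Q x) -> p \in X -> q \in X ->
  (forall x, x \in X -> P x -> x = p) -> (forall x, x \in X -> Q x -> x = q) ->
  X = [set p; q].
Proof.
move=> Pp Qq PQ pX qX up uq; apply/setP => x; rewrite !inE.
apply/idP/orP => [xX|[/eqP->|/eqP->]] //.
by case/orP: (PQ x xX) => [/(up x xX)->|/(uq x xX)->]; [left|right].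
Qed.

(** Otherwise the complement of [N] would be a co-module missing [X]. *)
Lemma covering_module N x y v : module T N -> x \in N -> y \in N -> x != y ->
  X \subset N -> v \in N.
Proof.
move=> mN xN yN xy /subsetP XN; apply: contraT => vN.
have /comodule_ntriv := ntrivI mN xN yN xy vN.
rewrite -comoduleC => /tight_meets[z]; rewrite inE => /negbTE zN /XN.
by rewrite zN.
Qed.

(** Each of [M :&: X], [M :\: X] and [X :\: M] reduces to one point: [a], [b] and [c]. The minimal
    co-modules of [a] and [c] form together a module containing [X], hence cover all vertices, and
    that of [a] must be [[set a]]. *)
Lemma inversion_singleton_case :
  (forall F, F \in mc T -> F \in nontrivial_modules T \/ exists x, F = [set x]) ->
  exists a c b e, [/\ X = [set a; c], [set a] \in mc T, ~: [set a] \in mc T &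
    [/\ c != a, b != a, b != c, T b c = e &
     (forall v, v != a -> T v a = e) /\
     (forall v, v \notin [set a; b; c] -> T v b = e)]].
Proof.
move=> mcP; have [[a aM aX] [[b bM bX] [c cM cX]]] := module_unmixed.
have extA a' : a' \in M -> a' \in X -> extreme a'.
  move=> aM' aX'; case: tX => _ /(_ _ aX')[F mF aF] _.
  have [nF|[x Fx]] := mcP _ mF.
    have [d [e [_ _ _ _ h]]] := twin_extreme aM' aX' mF aF nF.
    by exists e.
  apply: singleton_extreme; move: aF mF; rewrite Fx inE => /eqP->//.
have partner c' : c' \notin M -> c' \in X ->
    exists F, [/\ F \in mc T, F \in nontrivial_modules T, c' \in F & b \in F].
  move=> cM' cX'; case: tX => _ /(_ _ cX')[F mF cF] _.
  have [nF|[x Fx]] := mcP _ mF.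
    have [b' [bF' bM' bX']] := outer_partner cM' cX' mF cF nF.
    by exists F; rewrite (outside_point_unique extA bM bX bM' bX').
  (* A source or sink [c'] could not separate [a] from [b]. *)
  have [e he] : exists e, forall v, v != c' -> T c' v = e.
    by apply: singleton_mc; move: cF mF; rewrite Fx inE => /eqP->.
  have := arc_split aM bM cM' cX' aX bX.
  have neq m : m \in M -> m != c' by move=> mM'; rewrite eq_sym (in_outside mM').
  by rewrite !he ?neq //; case: e {he}.
have outF F x a' : F \in mc T -> x \in F -> x \in X -> a' \in X -> a' != x ->
    a' \notin F.
  move=> mF xF xX aX'; apply: contra_neqN => aF.
  exact: mem_setI1 (tight_private mF xF xX) aF aX'.
have arc_bc c' a' : c' \notin M -> c' \in X -> a' \in M -> a' \in X ->
    T c' a' = T b a'.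
  move=> cM' cX' aM' aX'; have [F [mF nF cF bF]] := partner _ cM' cX'.
  apply: (module_out (ntriv_module nF) cF bF).
  by apply: (outF _ c') => //; rewrite eq_sym (in_outside aM').
have uA a' : a' \in M -> a' \in X -> a' = a.
  move=> aM' aX'; apply: (inside_point_unique extA bM bX) => //.
  have := arc_split aM bM cM cX aX bX.
  rewrite (arc_split aM' bM cM cX aX' bX) !(arc_bc c) //.
  exact: negb_inj.
have uB b' : b' \in M -> b' \notin X -> b' = b.
  by move=> bM' bX'; apply: (outside_point_unique extA).
have uC c' : c' \in X -> c' \notin M -> c' = c.
  move=> cX' cM'; have [F [mF nF cF bF]] := partner _ cM cX.
  have [F' [mF' nF' cF' bF']] := partner _ cM' cX'.
  by apply: (outer_unique aM aX cM' cX' mF' cF' nF' cM cX mF cF nF);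
     rewrite !arc_bc.
have Xac : X = [set a; c].
  apply: (@two_points (mem M) [predC M]) => //=.
    by move=> x _; rewrite orbN.
  by move=> x xX xM; apply: uA.
have Mab m : m \in M -> m \in [set a; b].
  move=> mM'; rewrite !inE.
  have [mX|mX] := boolP (m \in X); first by rewrite (uA _ mM' mX) eqxx.
  by rewrite (uB _ mM' mX) eqxx orbT.
have [Fc [mFc nFc cFc bFc]] := partner _ cM cX.
have ca : c != a := in_outside aM cM.
have bc : b != c by apply: contraNneq cM => <-.
have ba : b != a by apply: contraNneq bX => ->.
have aFc : a \notin Fc by apply: (outF _ c); rewrite // eq_sym.
case: tX => _ /(_ _ aX)[Fa mFa aFa] _.
have cFa : c \notin Fa by apply: (outF _ a).
have mFa' : module T Fa.
  have [/ntriv_module//|[x Fax]] := mcP _ mFa.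
  by apply/moduleP => y z v; rewrite Fax !inE => /eqP-> /eqP->.
have cover v : v \in Fa :|: Fc.
  apply: (covering_module (x := a) (y := c)); rewrite ?inE ?aFa ?cFc ?orbT //.
  - apply/moduleP => y z u yF zF; rewrite !inE negb_or => /andP[uFa uFc].
    have ua : u != a by apply: in_outside uFa.
    have ub : u != b by apply: in_outside uFc.
    have uc : u != c by apply: in_outside uFc.
    have uX : u \notin X by rewrite Xac !inE negb_or ua uc.
    have uM : u \notin M.
      by apply/negP => /Mab; rewrite !inE (negbTE ua) (negbTE ub).
    have uab := arc_out aM bM uM uX.
    have step t : t \in Fa :|: Fc -> T u t = T u a.
      rewrite inE => /orP[tF|tF]; first by move/moduleP: mFa'; apply.
      by rewrite uab; move/moduleP: (ntriv_module nFc); apply.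
    by rewrite !step.
  - by rewrite eq_sym.
  - by rewrite Xac; apply/subsetP => x; rewrite !inE => /orP[]/eqP->;
       rewrite ?aFa ?cFc ?orbT.
have neqF : Fa != Fc by apply: contraNneq aFc => <-.
(* Overlapping minimal co-modules have two points each, too few to cover five vertices. *)
have disj x : x \in Fa -> x \notin Fc.
  move=> xFa; apply/negP => xFc.
  have [_ Fa2] := mc_overlap mFa mFc neqF xFa xFc.
  have [_ Fc2] : Fc \in nontrivial_modules T /\ #|Fc| = 2.
    by apply: (mc_overlap mFc mFa _ xFc xFa); rewrite eq_sym.
  have : #|V| <= #|Fa| + #|Fc|.
    rewrite -cardsUI -cardsT (@leq_trans #|Fa :|: Fc|) ?leq_addr //.
    by apply/subset_leq_card/subsetP => y _; apply: cover.
  by rewrite Fa2 Fc2; apply/negP; rewrite -ltnNge.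
have arcFc x y : x \in Fa -> y \in Fc -> T y x = T b a.
  move=> xFa yFc; rewrite (module_out (ntriv_module nFc) yFc bFc (disj _ xFa)).
  move/moduleP: mFa'; apply => //.
  by apply/negP => bFa; move: (disj b bFa); rewrite bFc.
have [nFa|[x Fax]] := mcP _ mFa.
  (* If [Fa] were [[set a; d]], then [d] would be a source or sink of [T] and [[set d]] a smaller
     co-module. *)
  have [d [e [dM dX Fad dae ae]]] := twin_extreme aM aX mFa aFa nFa.
  have da : d != a := in_outside aM dM.
  have dFa : d \in Fa by rewrite Fad !inE eqxx orbT.
  have cd : [set d] \in comodules T.
    apply: singleton_comodule => //; exists e => v vd.
    have := cover v; rewrite inE => /orP[|vFc].
      by rewrite Fad !inE (negbTE vd) orbF => /eqP->.
    have vd' : v != d by [].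
    rewrite (arcC T vd') (arcFc d v) // -(ae b) // (@arcC _ T b a) //.
  have /setP/(_ a) : [set d] = Fa.
    by apply: mc_min mFa cd _; rewrite sub1set.
  by rewrite aFa inE eq_sym (negbTE da).
have Faa : Fa = [set a] by move: aFa; rewrite Fax inE => /eqP->.
have FcE : ~: [set a] = Fc.
  apply/setP => y; rewrite !inE; apply/idP/idP => [ya|yF].
    by have := cover y; rewrite Faa !inE (negbTE ya).
  by apply: contraNneq aFc => <-.
have aE v : v != a -> T v a = T b a.
  by move=> va; apply: arcFc; rewrite // -FcE !inE.
exists a, c, b, (T b a); split=> //; [by rewrite -Faa|by rewrite FcE|split=> //].
  rewrite (arcC T (x := c)) 1?eq_sym // (arc_split aM bM cM cX aX bX) negbK.
  exact: aE.
split=> // v; rewrite !inE !negb_or -andbA => /and3P[va vb vc].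
rewrite -(aE v) //; symmetry; apply: arc_out => //.
  by apply/negP => /Mab; rewrite !inE (negbTE va) (negbTE vb).
by rewrite Xac !inE negb_or va vc.
Qed.


(** * A minimal co-module of several points that is not a module *)

Section NonmoduleCase.

Variable F0 : {set V}.
Hypothesis mF0 : F0 \in mc T.
Hypothesis nF0 : F0 \notin nontrivial_modules T.
Hypothesis F0_gt1 : 1 < #|F0|.

Lemma nonmodule_compl : ~: F0 \in nontrivial_modules T.
Proof.
by have := mc_comodule mF0; rewrite inE (negbTE nF0).
Qed.

Let mN : module T (~: F0) := ntriv_module nonmodule_compl.

(** If the complement of [F] were a module, [mc_cotypes] would make [F0] a module; if [F] met [F0],
    [mc_overlap] would. *)
Lemma nonmodule_others F : F \in mc T -> F != F0 ->
  F \in nontrivial_modules T /\ F \subset ~: F0.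
Proof.
move=> mF FF0; split.
  have := mc_comodule mF; rewrite inE => /orP[//|nF].
  case/negP: nF0; rewrite in_nontrivial F0_gt1 /=; apply/andP; split.
    by apply: (mc_cotypes mF0 mF) => //; [rewrite eq_sym|exact: nonmodule_compl].
  by apply: contraTneq nonmodule_compl => ->; rewrite setCT in_nontrivial cards0 /= andbF.
apply/subsetP => x xF; rewrite inE; apply: contra nF0 => xF0.
by have [] := mc_overlap mF0 mF (contra_neq (@esym _ _ _) FF0) xF0 xF.
Qed.

Lemma nonmodule_twin x x0 : x0 \in F0 -> x0 \in X -> x \in X -> x != x0 ->
  exists F, [/\ F \in mc T, x \in F, F \in nontrivial_modules T,
                F \subset ~: F0 & x0 \notin F].
Proof.
move=> x0F x0X xX xx0; case: tX => _ /(_ _ xX)[F mF xF] _.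
have FF0 : F != F0.
  apply: contra_neq xx0 => FF0; rewrite FF0 in xF.
  exact: mem_setI1 (tight_private mF0 x0F x0X) xF xX.
have [nF sF] := nonmodule_others mF FF0.
exists F; split=> //; apply: contraTN x0F => /(subsetP sF).
by rewrite inE.
Qed.

(** The other points of [X] lie in the module [~: F0], which [a0] sees uniformly; this leaves one
    point [c0] of [X] outside [M] and only [a0] inside. Then [M :|: ~: F0] is a module containing
    [X], hence everything, and [~: F0 :\ c0] is a module avoiding [X]. *)
Lemma inversion_inner_case a0 : a0 \in F0 -> a0 \in X -> a0 \in M ->
  exists c0 d e, [/\ X = [set a0; c0], ~: F0 = [set c0; d], T c0 d = e,
    T a0 c0 = e & forall v, v \in F0 -> v != a0 -> T v c0 = ~~ e].
Proof.
move=> a0F aX aM; have F0X := tight_private mF0 a0F aX.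
have [_ [_ [c0 cM cX]]] := module_unmixed.
have inN x : x \in X -> x != a0 -> x \in ~: F0.
  move=> xX; apply: contra_neqT; rewrite inE negbK => xF.
  exact: mem_setI1 F0X xF xX.
have a0N : a0 \notin ~: F0 by rewrite inE a0F.
have Mneq c : c \notin M -> c != a0 by apply: in_outside.
have c0N := inN _ cX (Mneq _ cM).
set e := T a0 c0.
have a0e v : v \in ~: F0 -> T a0 v = e by move=> vN; move/moduleP: mN; apply.
have ce c : c \in X -> c != a0 -> T c a0 = ~~ e.
  by move=> cX' ca0; rewrite (@arcC _ T a0 c) 1?eq_sym // a0e ?inN.
have [Fc [mFc cFc nFc sFc a0Fc]] := nonmodule_twin a0F aX cX (Mneq _ cM).
have uC c : c \in X -> c \notin M -> c = c0.
  move=> cX' cM'; have [F [mF cF nF _ _]] := nonmodule_twin a0F aX cX' (Mneq _ cM').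
  by apply: (outer_unique aM aX cM' cX' mF cF nF cM cX mFc cFc nFc);
     rewrite !ce ?Mneq.
have [b [bFc bM bX]] := outer_partner cM cX mFc cFc nFc.
have bN : b \in ~: F0 := subsetP sFc _ bFc.
(* Such an [a] would be extreme, seeing [a0], [b] and hence [c0] alike; but its arc has value [~~ e]
   towards [a0] and [e] towards [c0]. *)
have uA a : a \in X -> a \in M -> a = a0.
  move=> aX' aM'; apply: contraTeq isT => aa0.
  have [F [mF aF nF _ _]] := nonmodule_twin a0F aX aX' aa0.
  have [_ [f [_ _ _ _ af]]] := twin_extreme aM' aX' mF aF nF.
  have ca : c0 != a := in_outside aM' cM.
  have aFc : a \notin Fc.
    apply: contra_neqN ca => aFc; symmetry.
    exact: mem_setI1 (tight_private mFc cFc cX) aFc aX'.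
  have ba : b != a by apply: contraNneq bX => ->.
  have h1 : T a c0 = T a b by move/moduleP: (ntriv_module nFc); apply.
  have h2 : T c0 a = ~~ e.
    rewrite -(ce c0) ?Mneq //; apply: negb_inj.
    by rewrite -(arc_split aM' bM cM cX aX' bX) (arc_split aM bM cM cX aX bX).
  have h3 : T a a0 = T a b by rewrite !af // eq_sym.
  move: h3; rewrite ce // -h1 (arcC T ca) h2.
  by case: (e).
have Xac : X = [set a0; c0].
  apply: (@two_points (mem M) [predC M]) => //=.
    by move=> x _; rewrite orbN.
have XMN v : v \in X -> v \in M :|: ~: F0.
  by rewrite {1}Xac !in_setU !in_set1 => /orP[]/eqP->; rewrite ?aM ?c0N ?orbT.
have cover v : v \in M :|: ~: F0.
  have aU : a0 \in M :|: ~: F0 by rewrite in_setU aM.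
  have cU : c0 \in M :|: ~: F0 by rewrite in_setU c0N orbT.
  apply: (covering_module (x := a0) (y := c0)) => //.
  - apply/moduleP => x y u xU yU uU.
  have uX : u \notin X by apply: contra uU; apply: XMN.
  move: uU; rewrite in_setU negb_or => /andP[uM uN].
  have step t : t \in M :|: ~: F0 -> T u t = T u b.
    rewrite in_setU => /orP[tM|tN]; first exact: arc_out.
    by move/moduleP: mN; apply.
  by rewrite !step.
  - by rewrite eq_sym Mneq.
  - exact/subsetP.
have c0B f : f \in M -> f \notin X -> T c0 f = e.
  by move=> fM fX; rewrite (arc_split aM fM cM cX aX fX) ce ?Mneq // negbK.
have [f fF fa] : exists2 f, f \in F0 & f != a0.
  have /card_gt1P[x [y [xF yF xy]]] := F0_gt1.
  by have [xa|xa] := eqVneq x a0; [exists y; rewrite // -xa eq_sym|exists x].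
have fX : f \notin X by apply: contra_neqN fa; apply: mem_setI1 F0X fF.
have fM : f \in M by have := cover f; rewrite in_setU inE fF orbF.
(* Outside [M], such a [v] would see [a0] and [f] alike, whereas [c0], in the same module, separates
   them. *)
have NM v : v \in ~: F0 -> v != c0 -> v \in M.
  move=> vN vc; apply: contraT => vM.
  have vX : v \notin X by apply: contra_neqN vc => vX; apply: uC.
  have fN : f \notin ~: F0 by rewrite inE fF.
  have va : v != a0 := in_outside aM vM.
  have := arc_out aM fM vM vX.
  rewrite (module_out mN vN c0N fN) c0B // (@arcC _ T a0 v) 1?eq_sym //.
  by rewrite a0e //; case: (e).
have NX v : v \in ~: F0 -> v != c0 -> v \notin X.
  move=> vN vc; rewrite Xac in_set2 negb_or vc andbT.
  by apply: contraNneq a0N => <-.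
exists c0, b, e; split=> //.
- apply/setP => x; rewrite in_set2; apply/idP/orP => [xN|[/eqP->|/eqP->]] //.
  have [xc|xc] := eqVneq x c0; [by left|right].
  have bc : b != c0 by apply: contraNneq cM => <-.
  apply/eqP; apply: (@no_module_avoiding (~: F0 :\ c0) c0).
  + apply/moduleP => y z v; rewrite !in_setD1 => /andP[yc yN] /andP[zc zN].
    rewrite negb_and negbK => /orP[/eqP->|vN].
      by rewrite !c0B ?NM ?NX.
    by move/moduleP: mN; apply.
  + by rewrite !inE eqxx.
  + by move=> y; rewrite in_setD1 => /andP[yc yN]; apply: NX.
  + by rewrite in_setD1 xc.
  + by rewrite in_setD1 bc.
- exact: c0B.
move=> v vF va; have vX : v \notin X.
  by apply: contra_neqN va; apply: mem_setI1 F0X vF.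
have vM : v \in M by have := cover v; rewrite in_setU inE vF orbF.
by rewrite (@arcC _ T c0 v) ?c0B // (in_outside vM cM).
Qed.

(** Since [c0] separates [a] from [b] but sees [~: F0] uniformly, [b] lies in [F0]. The points of
    [M :&: X] are extreme by [twin_extreme], which reduces [M] to [a] and [b]; then no third vertex
    except [c0] separates these two. *)
Lemma inversion_outer_case c0 : c0 \in F0 -> c0 \in X -> c0 \notin M ->
  exists a d e, [/\ X = [set c0; a], ~: F0 = [set a; d], T a d = e &
    exists b, [/\ b \in F0, b != c0, T b a = e, T c0 b = ~~ T c0 a
     & forall v, v \in F0 -> v != b -> v != c0 -> T v b = T v a]].
Proof.
move=> cF cX cM; have F0X := tight_private mF0 cF cX.
have [[a aM aX] [[b bM bX] _]] := module_unmixed.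
have cN : c0 \notin ~: F0 by rewrite inE cF.
have Mneq x : x \in M -> x != c0 by move=> xM; rewrite eq_sym (in_outside xM cM).
have inN x : x \in X -> x != c0 -> x \in ~: F0.
  move=> xX; apply: contra_neqT; rewrite inE negbK => xF.
  exact: mem_setI1 F0X xF xX.
have extA x : x \in M -> x \in X -> extreme x.
  move=> xM xX; have [F [mF xF nF _ _]] := nonmodule_twin cF cX xX (Mneq _ xM).
  by have [_ [e [_ _ _ _ h]]] := twin_extreme xM xX mF xF nF; exists e.
have aN := inN _ aX (Mneq _ aM).
have cb := arc_split aM bM cM cX aX bX.
have bN : b \notin ~: F0.
  apply/negP => bN; move: cb; move/moduleP: mN => /(_ b a c0 bN aN cN) ->.
  by case: (T c0 a).
have bF : b \in F0 by rewrite inE negbK in bN.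
have uB b' : b' \in M -> b' \notin X -> b' = b.
  by move=> bM' bX'; apply: (outside_point_unique extA).
have uC c : c \in X -> c \notin M -> c = c0.
  move=> cX' cM'; apply: contraTeq isT => cc0.
  have [F [mF cF' nF sF _]] := nonmodule_twin cF cX cX' cc0.
  have [b' [bF' bM' bX']] := outer_partner cM' cX' mF cF' nF.
  by move: (subsetP sF _ bF'); rewrite (uB b') // (negbTE bN).
have uA a' : a' \in X -> a' \in M -> a' = a.
  move=> aX' aM'; apply: (inside_point_unique extA bM bX) => //.
  by move/moduleP: mN; apply=> //; apply: inN (Mneq _ aM').
have Xca : X = [set c0; a].
  apply: (@two_points [predC M] (mem M)) => //=.
    by move=> x _; rewrite orNb.
have Mab m : m \in M -> m \in [set a; b].
  move=> mM'; rewrite in_set2.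
  have [mX|mX] := boolP (m \in X); first by rewrite (uA _ mX mM') eqxx.
  by rewrite (uB _ mM' mX) eqxx orbT.
have ba : b != a by apply: contraNneq bX => ->.
have out v : v \notin [set a; b] -> v != c0 -> T v b = T v a.
  rewrite in_set2 negb_or => /andP[va vb] vc; apply: arc_out => //.
    by apply/negP => /Mab; rewrite in_set2 (negbTE va) (negbTE vb).
  by rewrite Xca in_set2 negb_or vc va.
have [F [mF aF nF sF _]] := nonmodule_twin cF cX aX (Mneq _ aM).
have [d [e [dM dX FE dae ae]]] := twin_extreme aM aX mF aF nF.
have dF : d \in F by rewrite FE in_set2 eqxx orbT.
have dN : d \in ~: F0 := subsetP sF _ dF.
have da : d != a := in_outside aM dM.
have bNe v : v \in ~: F0 -> T b v = ~~ e.
  move=> vN; have -> : T b v = T b a by move/moduleP: mN; apply.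
  by rewrite (@arcC _ T a b) ?ae // eq_sym.
exists a, d, (~~ e); split=> //.
- apply/setP => x; rewrite in_set2; apply/idP/orP => [xN|[/eqP->|/eqP->]] //.
  have [xa|xa] := eqVneq x a; [by left|right].
  apply/eqP; apply: (@no_module_avoiding (~: F0 :\ a) a).
  + apply/moduleP => y z v; rewrite !in_setD1 => /andP[ya yN] /andP[za zN].
    rewrite negb_and negbK => /orP[/eqP->|vN]; last by move/moduleP: mN; apply.
    have step t : t != a -> t \in ~: F0 -> T a t = ~~ e.
      move=> ta tN; have tb : t != b by apply: contraNneq bN => <-.
      have tc : t != c0 by apply: contraNneq cN => <-.
      have := out t; rewrite in_set2 negb_or ta tb => /(_ isT tc) h.
      by rewrite (arcC T ta) -h (@arcC _ T b t) 1?eq_sym // bNe ?negbK.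
    by rewrite !step.
  + by rewrite !inE eqxx.
  + move=> y; rewrite in_setD1 Xca in_set2 negb_or => /andP[ya yN].
    by rewrite ya andbT; apply: contraNneq cN => <-.
  + by rewrite in_setD1 xa.
  + by rewrite in_setD1 da.
- by rewrite (arcC T da) dae.
exists b; split=> //; first exact: Mneq; first by rewrite bNe.
move=> v vF vb vc; apply: out vc; rewrite in_set2 negb_or vb andbT.
by apply: contraTneq aN => <-; rewrite inE vF.
Qed.

End NonmoduleCase.

End ModuleOfInversion.

(** * The exceptional transversals *)

Section TightTransversals.

Variables (V : finType) (T : tournament V).
Hypothesis V5 : 5 <= #|V|.
Implicit Types (a b c v x y : V) (E F N X : {set V}).

(** The split is on whether some minimal co-module of several points is not a module. The clauses on
    arcs record how the choice [X] fails, for the later counting. *)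
Lemma inversion_decomposable X : tight_transversal T X ->
  ~~ indecomposable (Inv T X) ->
  (exists a c b e, [/\ X = [set a; c], [set a] \in mc T, ~: [set a] \in mc T &
    [/\ c != a, b != a, b != c, T b c = e &
     (forall v, v != a -> T v a = e) /\
     (forall v, v \notin [set a; b; c] -> T v b = e)]]) \/
  (exists F0 x0 x1 d e, [/\ F0 \in mc T, 1 < #|F0|, F0 \notin nontrivial_modules T,
    ~: F0 = [set x1; d] &
    [/\ X = [set x0; x1], x0 \in F0, T x1 d = e &
      (T x0 x1 = e /\ forall v, v \in F0 -> v != x0 -> T v x1 = ~~ e) \/
      (exists b, [/\ b \in F0, b != x0, T b x1 = e, T x0 b = ~~ T x0 x1
         & forall v, v \in F0 -> v != b -> v != x0 -> T v b = T v x1])]]).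
Proof.
move=> tX /indecomposableP/eqP/set0Pn[M nM].
have [/existsP[F0 /and3P[mF0 nF0 F01]]|/existsPn mcP] :=
  boolP [exists F, [&& F \in mc T, F \notin nontrivial_modules T & 1 < #|F|]].
- right; case: (tX) => /(_ _ mF0)[x0 /setI1_mem[x0F x0X]] _ _.
  have [x0M|x0M] := boolP (x0 \in M).
    have [x1 [d [e [? ? ? ? ?]]]] := inversion_inner_case tX nM mF0 nF0 F01 x0F x0X x0M.
    by exists F0, x0, x1, d, e; split=> //; split=> //; left.
  have [x1 [d [e [? ? ? ?]]]] := inversion_outer_case tX nM mF0 nF0 F01 x0F x0X x0M.
  by exists F0, x0, x1, d, e; split=> //; split=> //; right.
left; apply: (inversion_singleton_case V5 tX nM) => F mF.
have [nF|nF] := boolP (F \in nontrivial_modules T); [by left|right].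
have := mcP F; rewrite mF nF /= -leqNgt => F1.
have [x xF] := comodule_neq0 (mc_comodule mF).
exists x; apply/eqP; rewrite eq_sym eqEcard sub1set xF cards1.
exact: F1.
Qed.

(** By exactness the minimal co-modules inside [N] are singletons, hence sources or sinks. This is
    the configuration that the numbering of chains has to avoid. *)
Lemma module_in_exact_transversal X N :
  (forall F, F \in mc T -> exists x, F :&: X = [set x]) ->
  (forall x, x \in X -> exists2 F, F \in mc T & x \in F) ->
  N \in nontrivial_modules T -> N \subset X ->
  exists a b c e, [/\ [set a] \in mc T, N = [set a; b], b != a &
    [/\ forall v, v != a -> T a v = e,
        forall v, v != a -> v != b -> T b v = e, c != a, c != b
      & [set b; c] \in mc T /\ [set b; c] \in nontrivial_modules T]].
Proof.
move=> H1 H2 nN /subsetP NX.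
have mcN F : F \in mc T -> F \subset N -> exists x, F = [set x].
  move=> mF /subsetP FN; have [x Fx] := H1 _ mF; exists x.
  by rewrite -Fx; symmetry; apply/setIidPl/subsetP => y /FN/NX.
have [F mF FN] := mc_sub (comodule_ntriv nN).
have [a Fa] := mcN _ mF FN; rewrite {}Fa sub1set in mF FN.
have [e ae] := singleton_mc mF.
have [u uN] := comodule_proper (comodule_ntriv nN).
have outN x v : x \in N -> v \notin N -> T x v = e.
  move=> xN vN; rewrite (module_out (ntriv_module nN) xN FN vN) ae //.
  exact: in_outside vN.
have [b bN ba] : exists2 b, b \in N & b != a.
  have /card_gt1P[x [y [xN yN xy]]] := ntriv_gt1 nN.
  by have [xa|xa] := eqVneq x a; [exists y; rewrite // -xa eq_sym|exists x].
have Nab : N = [set a; b].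
  apply/setP => x; rewrite in_set2; apply/idP/orP => [xN|[/eqP->|/eqP->]] //.
  have [xa|xa] := eqVneq x a; [by left|right].
  apply: contraTT isT => xb.
  have nNa : N :\ a \in nontrivial_modules T.
    apply: (ntrivI _ _ _ xb (v := a)); rewrite ?in_setD1 ?xa ?ba ?eqxx //.
    apply/moduleP => y z v; rewrite !in_setD1 => /andP[ya yN] /andP[za zN].
    rewrite negb_and negbK => /orP[/eqP->|vN]; first by rewrite !ae.
    by move/moduleP: (ntriv_module nN); apply.
  have [F' mF' sF'] := mc_sub (comodule_ntriv nNa).
  have [a' Fa'] := mcN _ mF' (subset_trans sF' (subsetDl _ _)).
  rewrite {}Fa' sub1set in_setD1 in mF' sF'.
  have [a'a a'N] := andP sF'; have [e' ae'] := singleton_mc mF'.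
  (* Compared at [u], both [a] and [a'] are sources or both are sinks, which the arc between them
     forbids. *)
  have := arcC T a'a; rewrite (ae _ a'a) (ae' a) 1?eq_sym //.
  rewrite -(ae' u) ?(outN a' u) ?(in_outside a'N) //.
  by case: (e).
have be v : v != a -> v != b -> T b v = e.
  by move=> va vb; rewrite outN // Nab in_set2 negb_or va.
have [F' mF' bF'] := H2 _ (NX _ bN).
have aF' : a \notin F'.
  by apply: contra ba => /(mc_singleton_eq mF mF') Fa; rewrite Fa inE in bF'.
exists a, b.
have := mc_comodule mF'; rewrite inE => /orP[nF'|nF'].
  have [c cF' cb] : exists2 c, c \in F' & c != b.
    have /card_gt1P[x [y [xN yN xy]]] := ntriv_gt1 nF'.
    by have [xa|xa] := eqVneq x b; [exists y; rewrite // -xa eq_sym|exists x].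
  have neqa y : y \in F' -> y != a by move=> yF; apply: contraNneq aF' => <-.
  have FE : F' = [set b; c].
    apply/setP => x; rewrite in_set2; apply/idP/orP => [xF|[/eqP->|/eqP->]] //.
    have [xb|xb] := eqVneq x b; [by left|right].
    apply: contraTT isT => xc.
    have nFb : F' :\ b \in nontrivial_modules T.
      apply: (ntrivI _ _ _ xc (v := b)); rewrite ?in_setD1 ?xb ?cb ?eqxx //.
      apply/moduleP => y z v; rewrite !in_setD1 => /andP[yb yF] /andP[zb zF].
      rewrite negb_and negbK => /orP[/eqP->|vN]; first by rewrite !be ?neqa.
      by move/moduleP: (ntriv_module nF'); apply.
    have /setP/(_ b) := mc_min mF' (comodule_ntriv nFb) (subsetDl _ _).
    by rewrite bF' in_setD1 eqxx.
  by exists c, e; split=> //; split; rewrite -?FE ?neqa.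
(* If the complement of [F'] were a module, it would contain [a] and another vertex [s], which [b]
   separates. *)
have /card_gt1P[t [t' [tF tF' tt']]] := ntriv_gt1 nF'.
have [s sF sa] : exists2 s, s \in ~: F' & s != a.
  by have [xa|xa] := eqVneq t a; [exists t'; rewrite // -xa eq_sym|exists t].
have sb : s != b by apply: contraTneq sF => ->; rewrite inE bF'.
have : T b a = T b s.
  by move/moduleP: (ntriv_module nF'); apply=> //; rewrite !inE ?bF'.
rewrite (be s sa sb) (@arcC _ T a b) 1?eq_sym // ae //.
by case: (e).
Qed.

Lemma disjoint_comodules (P : {set {set V}}) :
  P \subset comodules T -> trivIset P -> #|P| <= comodular_index T.
Proof.
move=> sP tP; rewrite /comodular_index.
by rewrite (@leq_bigmax_cond _ _ (fun P : {set {set V}} => #|P|) P) ?sP.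
Qed.

Lemma comodular_index_ge2 N : N \in comodules T -> 2 <= comodular_index T.
Proof.
move=> cN; have [x xN] := comodule_neq0 cN.
have NC : N != ~: N by apply/eqP => /setP/(_ x); rewrite inE xN.
have <- : #|[set N; ~: N]| = 2 by rewrite cards2 NC.
apply: disjoint_comodules.
  by apply/subsetP => E; rewrite in_set2 => /orP[]/eqP->; rewrite ?comoduleC.
have dN : [disjoint N & ~: N] by rewrite disjoints_subset setCK.
apply/trivIsetP => E F; rewrite !in_set2.
by do 2![case/orP=> /eqP->]; rewrite ?eqxx // disjoint_sym.
Qed.

(** The remaining conditions of [tr] follow from indecomposability, with the size bound giving
    minimality. *)
Definition indecomposable_inversion X :=
  [/\ forall F, F \in mc T -> exists x, F :&: X = [set x],
      #|X| <= comodular_index T & indecomposable (Inv T X)].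

Lemma setI2 F x y : x \in F -> y \notin F -> F :&: [set x; y] = [set x].
Proof.
move=> xF yF; apply/setP => z; rewrite !inE.
have [->|zx] := eqVneq z x; first by rewrite xF.
by have [->|] := eqVneq z y; rewrite ?(negbTE yF) ?andbF.
Qed.

Lemma two_mc_tight E F x y : E \in mc T -> F \in mc T ->
  (forall G, G \in mc T -> G = E \/ G = F) -> x \in E -> y \notin E ->
  y \in F -> x \notin F ->
  (forall N, N \in nontrivial_modules T -> ~~ (N \subset [set x; y])) ->
  tight_transversal T [set x; y].
Proof.
move=> mE mF mcEF xE yE yF xF h; split=> // [G /mcEF[]->|z].
- by exists x; rewrite setI2.
- by exists y; rewrite setUC setI2.
by rewrite in_set2 => /orP[]/eqP->; [exists E|exists F].
Qed.

(* If every choice of c failed, c would be the only e-neighbour of some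
   b = h c; then h is a permutation, every vertex has just one e-neighbour, and
   two vertices with the same e-neighbour cannot be joined by an arc. *)
Lemma endpoint_inversion a e : [set a] \in mc T -> ~: [set a] \in mc T ->
  (forall v, v != a -> T v a = e) -> exists X, indecomposable_inversion X.
Proof.
move=> ma mA ae; set A := ~: [set a].
have mcA F : F \in mc T -> F = [set a] \/ F = A.
  move=> mF; have [aF|aF] := boolP (a \in F).
    by left; apply: mc_singleton_eq ma mF aF.
  right; apply: mc_min mA (mc_comodule mF) _.
  by apply/subsetP => x xF; rewrite !inE; apply: contraNneq aF => <-.
have A4 : 3 < #|A| by rewrite cardsC1 -ltnS prednK // (leq_trans _ V5).
have aA : a \notin A by rewrite !inE negbK.
have neqA x : x != a -> x \in A by rewrite !inE.
have tight c : c \in A -> tight_transversal T [set a; c].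
  move=> cA; have ca : c \notin [set a] by rewrite -in_setC.
  apply: (two_mc_tight ma mA) => //; first by rewrite inE.
  move=> N nN; apply/negP => NX.
  have [F mF F2] : exists2 F, F \in mc T & #|F| = 2 .
    have H1 F : F \in mc T -> exists x, F :&: [set a; c] = [set x].
      move=> /mcA[]->; [exists a|exists c]; first by rewrite setI2 ?set11.
      by rewrite setUC setI2.
    have H2 x : x \in [set a; c] -> exists2 F, F \in mc T & x \in F.
      rewrite in_set2 => /orP[]/eqP->; first by exists [set a]; rewrite ?set11.
      by exists A.
    have [x [b [d [f [_ _ _ [_ _ _ db [mF _]]]]]]] :=
      module_in_exact_transversal H1 H2 nN NX.
    by exists [set b; d]; rewrite // cards2 eq_sym db.
  by have [FE|FE] := mcA _ mF; rewrite FE in F2; [rewrite cards1 in F2|rewrite F2 in A4].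
(* How [[set a; c]] fails: among the vertices other than [a] and [b], only [c] receives from [b] an
   arc of value [e]. *)
pose bad b c := [&& b != a, b != c, T b c == e &
  [forall v, (v \notin [set a; b; c]) ==> (T v b == e)]].
have [/exists_inP[c cA ic]|/exists_inPn allbad] :=
    boolP [exists c in A, indecomposable (Inv T [set a; c])].
  exists [set a; c]; split=> //; first by case: (tight c cA).
  by apply: leq_trans (comodular_index_ge2 (mc_comodule ma)); rewrite cards2; case: eqP.
have {allbad} ex_bad c : c \in A -> exists b, bad b c.
  move=> cA; have [] := inversion_decomposable (tight c cA) (allbad c cA); last first.
    move=> [F0 [_ [_ [_ [_ [mF0 F01 nF0 _ _]]]]]].
    have := mc_comodule mF0; rewrite inE (negbTE nF0) /= => /ntriv_gt1.
    by have [FE|FE] := mcA _ mF0; move: F01; rewrite FE ?setCK cards1.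
  move=> [a' [c' [b [e' [Xac ma' _ [ca' ba' bc' bce [ae' be']]]]]]].
  have aa' : a' = a.
    have [/setP/(_ a')|FE] := mcA _ ma'; first by rewrite !inE eqxx => /esym/eqP.
    by move: A4; rewrite -FE cards1.
  subst a'; have cc' : c' = c.
    by move/setP/(_ c'): Xac; rewrite !in_set2 eqxx orbT (negbTE ca') => /eqP.
  subst c'; have ee' : e' = e by rewrite -(ae _ ca') ae'.
  exists b; rewrite /bad ba' bc' bce ee' eqxx /=.
  by apply/forallP => v; apply/implyP => /be'->; rewrite ee'.
have badE b c v : bad b c -> v != a -> v != b -> v != c -> T v b = e.
  case/and4P=> _ _ _ /forallP/(_ v)/implyP be va vb vc; apply/eqP/be.
  by rewrite !inE !negb_or va vb.
have bad_fun b c c' : bad b c -> bad b c' -> c \in A -> c = c'.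
  move=> bc bc' cA; apply: contraTeq isT => cc'.
  have ca : c != a by move: cA; rewrite !inE.
  have /and4P[_ nbc /eqP ebc _] := bc.
  by have := arcC T nbc; rewrite (badE b c') // 1?eq_sym // ebc; case: (e).
pose h c := odflt a [pick b | bad b c].
have hP c : c \in A -> bad (h c) c.
  move=> cA; rewrite /h; case: pickP => // no.
  by have [b] := ex_bad c cA; rewrite no.
have hA : h @: A = A.
  apply/eqP; rewrite eqEcard card_in_imset ?leqnn ?andbT.
    by apply/subsetP => _ /imsetP[c cA ->]; apply: neqA; case/and4P: (hP c cA).
  move=> c c' cA cA' hcc'; apply: (bad_fun (h c)) => //; first exact: hP.
  by rewrite hcc'; apply: hP.
have ex_nbr b : b \in A -> exists2 c, c \in A & bad b c.
  by rewrite -{1}hA => /imsetP[c cA ->]; exists c; rewrite ?hP.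
have [b0 b0A] : exists b, b \in A by apply/card_gt0P; apply: leq_trans A4.
have [c0 c0A bc0] := ex_nbr _ b0A.
(* Four points in [A] leave two besides [b0] and [c0]; both turn out to have [b0] as their
   [e]-neighbour. *)
have /card_gt1P[v [w [vR wR vw]]] : 1 < #|A :\ b0 :\ c0|.
  have := A4; rewrite (cardsD1 b0 A) b0A (cardsD1 c0 (A :\ b0)) !in_setD1 c0A.
  by case: (c0 != b0) => // /ltnW.
have to_b0 x : x \in A :\ b0 :\ c0 -> bad x b0 /\ x != a.
  rewrite !in_setD1 => /and3P[xc xb xA]; split; last by move: xA; rewrite !inE.
  have xa : x != a by move: xA; rewrite !inE.
  have xbe := badE _ _ _ bc0 xa xb xc.
  have [c cA xc'] := ex_nbr _ xA.
  have [->//|b0c] := eqVneq b0 c.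
  have b0a : b0 != a by move: b0A; rewrite !inE.
  have := badE _ _ _ xc' b0a; rewrite eq_sym xb => /(_ isT b0c).
  by rewrite (arcC T xb) xbe; case: (e).
have [vb va] := to_b0 _ vR; have [wb wa] := to_b0 _ wR.
have wb0 : w != b0 by move: wR; rewrite !in_setD1 => /and3P[].
have vb0 : v != b0 by move: vR; rewrite !in_setD1 => /and3P[].
have wv : w != v by rewrite eq_sym.
have := arcC T vw; rewrite (badE _ _ _ vb wa wv wb0) (badE _ _ _ wb va vw vb0).
by case: (e).
Qed.

(** Each [y] in [F0] is either the only point of the counted set, or is determined by a point [b] of
    it, as the only vertex of [F0] besides [b] that sees [b] and [x] differently; [g] recovers [y]
    from [b]. *)
Lemma card_isolating_choices F0 x e :
  (forall y, y \in F0 ->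
    (T y x = e /\ forall v, v \in F0 -> v != y -> T v x = ~~ e) \/
    (exists b, [/\ b \in F0, b != y, T b x = e, T y b = ~~ T y x
       & forall v, v \in F0 -> v != b -> v != y -> T v b = T v x])) ->
  #|F0| <= #|[set b in F0 | T b x == e]| + (#|[set b in F0 | T b x == e]| == 1).
Proof.
move=> bad; set I := [set b in F0 | T b x == e].
pose g b := odflt b [pick y in F0 | (b != y) && (T y b != T y x)].
have sF : F0 \subset g @: I :|: (if #|I| == 1 then I else set0).
  apply/subsetP => y yF; rewrite inE; case: (bad y yF) => [[yx other]|].
    have -> : I = [set y].
      apply/setP => v; rewrite !inE; have [->|vy] := eqVneq v y.
        by rewrite yF yx eqxx.
      by apply/negbTE/andP => -[vF]; rewrite other //; case: (e).
    by rewrite cards1 /= inE eqxx orbT.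
  move=> [b [bF ney bx yb other]]; apply/orP; left.
  apply/imsetP; exists b; first by rewrite inE bF bx eqxx.
  rewrite /g; case: pickP => [z /and3P[zF bz zb]|/(_ y)] /=.
    apply: contraTeq zb => yz; rewrite other ?eqxx // eq_sym //.
  by rewrite /= yF ney yb; case: (T y x).
apply: leq_trans (subset_leq_card sF) _.
apply: leq_trans (leq_card_setU _ _) _.
apply: leq_add; first exact: leq_imset_card.
by case: eqP => [->|]; rewrite ?cards0.
Qed.

(** Here [mc T] consists of [F0] and its complement, so a point of [F0] with [p] or [q] is always
    tight. If all these choices failed, [card_isolating_choices] would apply both with [p] and with
    [q]. *)
Lemma twin_complement_inversion F0 p q : F0 \in mc T -> 1 < #|F0| ->
  F0 \notin nontrivial_modules T -> ~: F0 = [set p; q] ->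
  exists X, indecomposable_inversion X.
Proof.
move=> mF0 F01 nF0 NE.
have nN : ~: F0 \in nontrivial_modules T by apply: nonmodule_compl.
have mN : ~: F0 \in mc T.
  have [F mF sF] := mc_sub (comodule_ntriv nN).
  have FF0 : F != F0.
    apply/eqP => FF0; have [x xF] := comodule_neq0 (mc_comodule mF).
    by have := subsetP sF _ xF; rewrite inE -FF0 xF.
  have [nF _] := nonmodule_others mF0 nF0 F01 mF FF0.
  suff <- : F = ~: F0 by [].
  apply/eqP; rewrite eqEcard sF (leq_trans _ (ntriv_gt1 nF)) //.
  by rewrite NE cards2; case: (_ != _).
have mcE F : F \in mc T -> F = F0 \/ F = ~: F0.
  move=> mF; have [->|FF0] := eqVneq F F0; [by left|right].
  have [_ sF] := nonmodule_others mF0 nF0 F01 mF FF0.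
  exact: mc_min mN (mc_comodule mF) sF.
have no1 x : [set x] \notin mc T.
  apply/negP => /mcE[] FE; first by move: F01; rewrite -FE cards1.
  by have := ntriv_gt1 nN; rewrite -FE cards1.
have NX x0 x1 : x0 \in F0 -> x1 \in ~: F0 -> x0 \notin ~: F0 /\ x1 \notin F0.
  by rewrite !inE => -> ->.
have tight x0 x1 : x0 \in F0 -> x1 \in ~: F0 -> tight_transversal T [set x0; x1].
  move=> x0F x1N; have [x0N x1F] := NX _ _ x0F x1N.
  apply: (two_mc_tight mF0 mN) => //.
  move=> N nN'; apply/negP => sN.
  have H1 F : F \in mc T -> exists x, F :&: [set x0; x1] = [set x].
    move=> /mcE[]->; [exists x0|exists x1]; first by rewrite setI2.
    by rewrite setUC setI2.
  have H2 x : x \in [set x0; x1] -> exists2 F, F \in mc T & x \in F.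
    by rewrite in_set2 => /orP[]/eqP->; [exists F0|exists (~: F0)].
  have [x [b [d [f [mx _]]]]] := module_in_exact_transversal H1 H2 nN' sN.
  by rewrite (negbTE (no1 x)) in mx.
have [/existsP[x0 /exists_inP[x1 x1N /andP[x0F ix]]]|/existsPn allbad] :=
    boolP [exists x0, exists x1 in ~: F0,
             (x0 \in F0) && indecomposable (Inv T [set x0; x1])].
  exists [set x0; x1]; split=> //; first by case: (tight x0 x1 x0F x1N).
  apply: leq_trans (comodular_index_ge2 (mc_comodule mF0)).
  by rewrite cards2; case: (_ != _).
have bound x1 d : x1 != d -> ~: F0 = [set x1; d] ->
    #|F0| <= #|[set b in F0 | T b x1 == T x1 d]| +
             (#|[set b in F0 | T b x1 == T x1 d]| == 1).
  move=> x1d NE'; apply: card_isolating_choices => x0 x0F.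
  have x1N : x1 \in ~: F0 by rewrite NE' set21.
  have /exists_inPn/(_ _ x1N) := allbad x0; rewrite x0F /= => badx.
  have [|] := inversion_decomposable (tight x0 x1 x0F x1N) badx.
    by move=> [a [? [? [? [_ ma _ _]]]]]; rewrite (negbTE (no1 a)) in ma.
  move=> [F [y0 [y1 [d' [e [mF _ nF FE [XE y0F <-]]]]]]].
  have FF0 : F = F0 by have [//|FN] := mcE _ mF; rewrite FN nN in nF.
  subst F; have y1N : y1 \in ~: F0 by rewrite FE set21.
  have y0E : y0 = x0.
    have : y0 \in [set x0; x1] by rewrite XE set21.
    by rewrite in_set2 => /orP[]/eqP // yx; move: x1N; rewrite -yx inE y0F.
  have y1E : y1 = x1.
    have : y1 \in [set x0; x1] by rewrite XE set22.
    by rewrite in_set2 => /orP[]/eqP // yx; move: y1N; rewrite yx inE x0F.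
  subst y0 y1; have dE : d = d'.
    have : d \in [set x1; d'] by rewrite -FE NE' set22.
    by rewrite in_set2 eq_sym (negbTE x1d) => /eqP.
  by subst d'.
have pq : p != q.
  by apply: contraTneq (ntriv_gt1 nN) => pq; rewrite NE pq setUid cards1.
have F03 : 2 < #|F0|.
  have := cardsC F0; rewrite NE cards2 pq => h.
  by rewrite -(ltn_add2r 2) h.
have Bp := bound _ _ pq NE.
have Bq : #|F0| <= #|[set b in F0 | T b q == T q p]| +
             (#|[set b in F0 | T b q == T q p]| == 1).
  by apply: bound; rewrite 1?eq_sym // NE setUC.
(* Vertices of [F0] see [p] and [q] alike, and [T p q], [T q p] are opposite, so the two counted
   sets are complementary in [F0]. *)
have IC : [set b in F0 | T b q == T q p] = F0 :\: [set b in F0 | T b p == T p q].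
  apply/setP => b; rewrite !inE; case: (boolP (b \in F0)) => //= bF.
  have -> : T b q = T b p.
    move/moduleP: (ntriv_module nN); apply; rewrite ?NE ?set21 ?set22 //.
    by rewrite -NE inE bF.
  by rewrite (arcC T pq); case: (T b p); case: (T p q).
have := cardsID [set b in F0 | T b p == T p q] F0; rewrite -IC.
have -> : F0 :&: [set b in F0 | T b p == T p q] = [set b in F0 | T b p == T p q].
  by apply/setIidPr/subsetP => b; rewrite inE => /andP[].
(* The two bounds add up to 2 |F0| <= |F0| + 2. *)
move=> cF; suff : #|F0| <= 2 by rewrite leqNgt F03.
have := leq_add Bp Bq; rewrite addnACA cF leq_add2l => /leq_trans; apply.
by do 2!case: (_ == 1).
Qed.

End TightTransversals.

(** * Chains of twins *)

Section FunctionalRelations.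

Variables (V : finType) (s : rel V).
Hypothesis s_fun : forall x y z, s x y -> s x z -> y = z.

Lemma connect_ind (P : V -> Prop) x y : P x ->
  (forall y z, connect s x y -> P y -> s y z -> P z) -> connect s x y -> P y.
Proof.
move=> Px step /connectP[p]; elim/last_ind: p y => [|p z IH] y /=; first by move=> _ ->.
rewrite rcons_path last_rcons => /andP[sp sz] ->.
by apply: step (IH _ sp erefl) sz; apply/connectP; exists p.
Qed.

Lemma connect_fun x y z : s x y -> connect s x z = (z == x) || connect s y z.
Proof.
move=> sxy; apply/idP/orP => [|[/eqP->|]]; last 2 first.
- exact: connect0.
- exact: connect_trans (connect1 sxy).
move=> /connectP[[|w p] /= sp ->]; first by left.
by case/andP: sp => /(s_fun sxy)<- sp; right; apply/connectP; exists p.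
Qed.

Lemma card_connect_fun x y : s x y -> ~~ connect s y x ->
  #|connect s x| = #|connect s y|.+1.
Proof.
move=> sxy yx; have xx : x \in connect s x by exact: connect0.
rewrite (cardD1 x) xx add1n; congr _.+1.
apply: eq_card => z; rewrite inE /= -!topredE /= (connect_fun z sxy).
by have [->|] := eqVneq z x; rewrite ?(negbTE yx).
Qed.

(** A vertex without successor reaches only itself, and one is odd. *)
Lemma even_connect_next x : ~~ odd #|connect s x| -> exists y, s x y.
Proof.
move=> ev; apply/existsP; apply: contraNT ev => /existsPn no.
rewrite (@eq_card1 _ x) // => z; rewrite inE.
apply/idP/eqP => [|->]; last exact: connect0.
by move=> /connectP[[|w p] //= /andP[]]; rewrite (negbTE (no w)).
Qed.

End FunctionalRelations.

Section TwinChains.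

Variables (V : finType) (T : tournament V).
Hypothesis V5 : 5 <= #|V|.
Implicit Types (a b c v w x y z : V) (E F N X : {set V}).

(** Orienting each two-vertex module of [mc T] along its arc makes this relation and its converse
    functional and acyclic, so that its components are chains. *)
Definition next_twin : rel V := fun x y =>
  [&& T x y, [set x; y] \in mc T & [set x; y] \in nontrivial_modules T].

Definition prev_twin : rel V := fun x y => next_twin y x.

Lemma arc_neq x y : T x y -> x != y.
Proof. by apply: contraTneq => ->; rewrite tarc_irreflexive. Qed.

Lemma arc_asym x y : T x y -> ~~ T y x.
Proof. by move=> xy; rewrite (arcC T (arc_neq xy)) xy. Qed.

Lemma next_twin_arc x y : next_twin x y -> T x y.
Proof. by case/and3P. Qed.

Lemma next_twin_mc x y : next_twin x y -> [set x; y] \in mc T.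
Proof. by case/and3P. Qed.

Lemma next_twin_out x y v : next_twin x y -> v != x -> v != y -> T v x = T v y.
Proof.
case/and3P=> _ _ /ntriv_module/moduleP m vx vy.
by apply: m; rewrite ?set21 ?set22 // in_set2 negb_or vx.
Qed.

(** Seen from [z], the twins [x] and [y] force an arc from [y] to [z]; seen from [y], the twins [x]
    and [z] force the opposite arc. *)
Lemma next_twin_fun x y z : next_twin x y -> next_twin x z -> y = z.
Proof.
move=> xy xz; apply: contraTeq isT => yz.
have [Txy Txz] := (next_twin_arc xy, next_twin_arc xz).
have := next_twin_out xy; move/(_ z); rewrite eq_sym (arc_neq Txz) eq_sym yz.
move=> /(_ isT isT); rewrite (negbTE (arc_asym Txz)) => zy.
have := next_twin_out xz; move/(_ y); rewrite eq_sym (arc_neq Txy) yz.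
move=> /(_ isT isT); rewrite (negbTE (arc_asym Txy)) (arcC T (y := y)) 1?eq_sym //.
by rewrite -zy.
Qed.

Lemma prev_twin_fun x y z : prev_twin x y -> prev_twin x z -> y = z.
Proof.
rewrite /prev_twin => yx zx; apply: contraTeq isT => yz.
have [Tyx Tzx] := (next_twin_arc yx, next_twin_arc zx).
have := next_twin_out yx; move/(_ z); rewrite eq_sym yz (arc_neq Tzx).
move=> /(_ isT isT); rewrite Tzx => zy.
have := next_twin_out zx; move/(_ y); rewrite yz (arc_neq Tyx).
by move=> /(_ isT isT); rewrite Tyx (negbTE (arc_asym zy)).
Qed.

(** Each step passes between two twins, which [x] sees alike. *)
Lemma next_twin_after x y z : next_twin x y -> connect next_twin y z -> T x z.
Proof.
move=> xy; apply: (connect_ind (P := fun w => T x w)); first exact: next_twin_arc.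
move=> w w' _ xw ww'.
have xw' : x != w'.
  by apply: contraTneq (next_twin_arc ww') => <-; exact: arc_asym.
by rewrite -(next_twin_out ww') // arc_neq.
Qed.

Lemma next_twin_acyclic x y : next_twin x y -> ~~ connect next_twin y x.
Proof.
by move=> xy; apply/negP => /(next_twin_after xy); rewrite tarc_irreflexive.
Qed.

Lemma prev_twin_acyclic x y : prev_twin x y -> ~~ connect prev_twin y x.
Proof.
move=> yx; have -> : connect prev_twin y x = connect next_twin x y.
  exact: connect_rev next_twin y x.
exact: next_twin_acyclic.
Qed.

Definition twin F := (F \in nontrivial_modules T) && (#|F| == 2).

Lemma overlap_twin E F x : E \in mc T -> F \in mc T -> E != F ->
  x \in E -> x \in F -> twin E.
Proof.
move=> mE mF EF xE xF; have [nE E2] := mc_overlap mE mF EF xE xF.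
by rewrite /twin nE E2.
Qed.

Lemma twinE F : F \in mc T -> twin F -> exists x y, next_twin x y /\ F = [set x; y].
Proof.
move=> mF; rewrite /twin => /andP[nF /cards2P[x [y [xy FE]]]].
case Txy: (T x y); first by exists x, y; rewrite /next_twin -FE Txy mF nF.
exists y, x; rewrite FE setUC; split=> //.
by rewrite /next_twin setUC -FE mF nF (arcC T xy) Txy.
Qed.

(** * Alternate vertices of chains and the matching packing *)

Section Alternating.

Variable Y : pred V.
Hypothesis Y_closed : forall x y, next_twin x y -> Y x = Y y.

(* Chains inside Y are numbered from their last vertex, the others from their
   first one; numbers start at 1, and a chain contributes its vertices with an
   even number. *)
Definition rank x := if Y x then #|connect next_twin x| else #|connect prev_twin x|.

Lemma odd_rank x y : next_twin x y -> odd (rank x) = ~~ odd (rank y).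
Proof.
move=> xy; rewrite /rank (Y_closed xy); case: (Y y).
  by rewrite (card_connect_fun next_twin_fun xy) // next_twin_acyclic.
have yx : prev_twin y x by [].
by rewrite (card_connect_fun prev_twin_fun yx) ?prev_twin_acyclic //= negbK.
Qed.

Definition alternating_transversal : {set V} :=
  [set x | [exists F in mc T, (x \in F) &&
     (if twin F then ~~ odd (rank x) else Some x == [pick y in F])]].

(** Any other minimal co-module containing [x] overlaps [F] and is a twin too, so the choice of the
    witness does not matter. *)
Lemma alternating_twin F x : F \in mc T -> twin F -> x \in F ->
  (x \in alternating_transversal) = ~~ odd (rank x).
Proof.
move=> mF tF xF; rewrite inE; apply/exists_inP/idP => [[E mE /andP[xE]]|ev].
  case: ifP => // tE _; have EF : E != F by apply: contraFneq tE => ->.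
  by rewrite (overlap_twin mE mF EF xE xF) in tE.
by exists F; rewrite ?xF ?tF.
Qed.

Lemma alternating_nontwin F x : F \in mc T -> ~~ twin F -> x \in F ->
  (x \in alternating_transversal) = (Some x == [pick y in F]).
Proof.
move=> mF tF xF; rewrite inE; apply/exists_inP/idP => [[E mE /andP[xE]]|ev].
  have [->|EF] := eqVneq E F; first by rewrite (negbTE tF).
  by move: tF; rewrite (overlap_twin mF mE _ xF xE) // eq_sym.
by exists F; rewrite ?xF ?(negbTE tF).
Qed.

Lemma alternating_exact F : F \in mc T ->
  exists x, F :&: alternating_transversal = [set x].
Proof.
move=> mF; have [tF|tF] := boolP (twin F); last first.
  case pF : [pick y in F] => [x|].
    have xF : x \in F by move: pF; case: pickP => // y yF [<-].
    exists x; apply/setP => y; rewrite in_setI in_set1.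
    have [yF|yF] := boolP (y \in F); last first.
      by apply/esym/negbTE; apply: contraNneq yF => ->.
    by rewrite (alternating_nontwin mF) // pF.
  have [x xF] := comodule_neq0 (mc_comodule mF).
  by move: pF; case: pickP => // /(_ x); rewrite xF.
have [x [y [xy FE]]] := twinE mF tF; have rxy := odd_rank xy.
have aF z : z \in F -> (z \in alternating_transversal) = ~~ odd (rank z).
  exact: alternating_twin.
exists (if odd (rank x) then y else x); apply/setP => z; rewrite in_setI in_set1.
have [zF|zF] := boolP (z \in F); last first.
  apply/esym/negbTE; apply: contraNneq zF => ->.
  by case: ifP => _; rewrite FE ?set21 ?set22.
rewrite aF //; have xny := arc_neq (next_twin_arc xy).
move: zF; rewrite FE in_set2 => /orP[]/eqP->.
  by case: ifP => /=; rewrite ?eqxx // (negbTE xny).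
by rewrite rxy; case: ifP; rewrite ?eqxx // eq_sym (negbTE xny).
Qed.

(** On a chain, each even-numbered vertex is paired with the vertex numbered just before it; the
    parity tests mirror [rank]. *)
Definition packing : {set {set V}} :=
  [set F in mc T | twin F ==> [exists x, exists y, [&& next_twin x y, F == [set x; y]
     & if Y x then ~~ odd #|connect next_twin x| else ~~ odd #|connect prev_twin y|]]].

Lemma alternating_packing x : x \in alternating_transversal ->
  exists2 F, F \in packing & x \in F.
Proof.
move=> xX; move: (xX); rewrite inE => /exists_inP[F mF /andP[xF _]].
have [tF|tF] := boolP (twin F); last first.
  by exists F; rewrite // inE mF (negbTE tF).
have := alternating_twin mF tF xF; rewrite xX /rank => /esym.
case Yx: (Y x) => ev.
  have [y xy] := even_connect_next ev.
  exists [set x; y]; rewrite ?set21 // inE (next_twin_mc xy); apply/implyP => _.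
  by apply/existsP; exists x; apply/existsP; exists y; rewrite xy eqxx Yx.
have [y yx] := even_connect_next ev; rewrite /prev_twin in yx.
exists [set y; x]; rewrite ?set22 // inE (next_twin_mc yx); apply/implyP => _.
apply/existsP; exists y; apply/existsP; exists x.
by rewrite yx eqxx (Y_closed yx) Yx.
Qed.

Lemma packing_disjoint : trivIset packing.
Proof.
apply/trivIsetP => E F; rewrite [E \in _]inE [F \in _]inE => /andP[mE pE] /andP[mF pF] EF.
rewrite -setI_eq0; apply: contraTT isT => /set0Pn[z]; rewrite inE => /andP[zE zF].
have tE := overlap_twin mE mF EF zE zF.
have FE : F != E by rewrite eq_sym.
have tF := overlap_twin mF mE FE zF zE.
move: pE pF; rewrite tE tF /=.
move=> /existsP[x /existsP[y /and3P[xy /eqP EE evE]]].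
move=> /existsP[x' /existsP[y' /and3P[xy' /eqP FE' evF]]].
(* Consecutive twins are not both kept, since ranks alternate in parity along a chain. *)
have shift u v w : next_twin u v -> next_twin v w ->
    (if Y u then ~~ odd #|connect next_twin u| else ~~ odd #|connect prev_twin v|) ->
    (if Y v then ~~ odd #|connect next_twin v| else ~~ odd #|connect prev_twin w|) ->
    False.
  move=> uv vw; rewrite (Y_closed uv); case: (Y v).
    by rewrite (card_connect_fun next_twin_fun uv) ?next_twin_acyclic //= negbK => ->.
  have wv : prev_twin w v by [].
  rewrite (card_connect_fun prev_twin_fun wv) ?prev_twin_acyclic //= negbK.
  by move=> /negbTE->.
move: zE zF; rewrite EE FE' !in_set2 => /orP[]/eqP-> /orP[]/eqP zz; subst.
- by move: EF; rewrite (next_twin_fun xy xy') eqxx.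
- by case: (shift _ _ _ xy' xy).
- by case: (shift _ _ _ xy xy').
by move: EF; rewrite (prev_twin_fun (xy : prev_twin y' x) (xy' : prev_twin y' x')) eqxx.
Qed.

(** Each chosen point lies in a member of the packing, and by exactness distinct points lie in
    distinct members. *)
Lemma card_alternating : #|alternating_transversal| <= comodular_index T.
Proof.
apply: leq_trans (@disjoint_comodules _ T packing _ packing_disjoint); last first.
  by apply/subsetP => F; rewrite inE => /andP[/mc_comodule].
pose h x := odflt set0 [pick F in packing | x \in F].
have hP x : x \in alternating_transversal -> h x \in packing /\ x \in h x.
  move=> /alternating_packing[F FP xF]; rewrite /h.
  by case: pickP => [E /andP[]//|/(_ F)]; rewrite /= FP xF.
rewrite -(card_in_imset (f := h) (D := alternating_transversal)).
  by apply/subset_leq_card/subsetP => _ /imsetP[x /hP[]? _ ->].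
move=> x y xX yX hxy; have [hx xh] := hP x xX; have [_ yh] := hP y yX.
rewrite -hxy in yh; have mh : h x \in mc T by move: hx; rewrite inE => /andP[].
have [z zE] := alternating_exact mh.
by rewrite (mem_setI1 zE xh xX) (mem_setI1 zE yh yX).
Qed.

End Alternating.

Lemma next_twin_singletons x y : next_twin x y ->
  [set x] \notin mc T /\ [set y] \notin mc T.
Proof.
move=> xy; have neq := arc_neq (next_twin_arc xy).
split; apply/negP => /mc_singleton_eq/(_ (next_twin_mc xy)); rewrite ?set21 ?set22.
  by move=> /(_ isT)/setP/(_ y); rewrite !inE eqxx orbT eq_sym (negbTE neq).
by move=> /(_ isT)/setP/(_ x); rewrite !inE eqxx (negbTE neq).
Qed.

(** The chain from [b] fills everything between the source [a] and the sink [z]. Only here can the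
    numbering not be arranged at both ends. *)
Lemma single_chain a b y z : [set a] \in mc T -> [set z] \in mc T ->
  b != a -> (forall v, v != a -> T a v) ->
  (forall v, v != a -> v != b -> T b v) -> (forall v, v != z -> T v z) ->
  (forall v, v != z -> v != y -> T v y) -> connect next_twin b y ->
  ~~ odd #|connect next_twin b| -> transitive (tarc T) /\ ~~ odd #|V|.
Proof.
move=> ma mz ba Ta Tb Tz Ty by_ ev.
have noin v : ~~ T v a.
  by apply/negP => va; have := arc_asym va; rewrite Ta // arc_neq.
have [c bc] := even_connect_next ev.
have single x : connect next_twin b x -> [set x] \notin mc T.
  apply: (connect_ind (P := fun x => [set x] \notin mc T)).
    by have [] := next_twin_singletons bc.
  by move=> w w' _ _ /next_twin_singletons[].
(* Induction along the chain: the predecessors of [w'] are those of its twin [w], together with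
   [w]. *)
have below x : connect next_twin b x ->
    (forall w, T w x -> w = a \/ connect next_twin b w) /\
    (forall w u, T w x -> T u w -> T u x).
  apply: (connect_ind (P := fun x =>
    (forall w, T w x -> w = a \/ connect next_twin b w) /\
    (forall w u, T w x -> T u w -> T u x))).
    have inb w : T w b -> w = a.
      move=> wb; apply: contraTeq (arc_asym wb) => wa.
      by rewrite negbK Tb // arc_neq.
    split=> [w /inb|w u /inb->]; first by left.
    by rewrite (negbTE (noin u)).
  move=> w w' bw [inw trw] ww'.
  have up u : T u w -> T u w'.
    move=> uw; have uw' : u != w'.
      apply: contraTneq uw => ->; exact: arc_asym (next_twin_arc ww').
    by rewrite -(next_twin_out ww' (arc_neq uw) uw').
  have down u : T u w' -> u = w \/ T u w.
    move=> uw'; have [->|uw] := eqVneq u w; [by left|right].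
    by rewrite (next_twin_out ww') // arc_neq.
  split=> [u /down[->|/inw]|u t /down[->|uw] tu] //; first by right.
    exact: up.
  by apply: up; apply: trw tu.
have cover v : [|| v == a, v == z | connect next_twin b v].
  have [//|vz] := eqVneq v z; first by rewrite orbT.
  have [->|vy] := eqVneq v y; first by rewrite by_ !orbT.
  by have [/(_ v (Ty v vz vy))[->|->] _] := below y by_; rewrite ?eqxx ?orbT.
split.
  move=> x w u wx xu; have /or3P[/eqP ua|/eqP uz|bu] := cover u.
  - by rewrite ua (negbTE (noin x)) in xu.
  - rewrite uz; apply: Tz; apply: contraTneq wx => ->.
    by rewrite uz in xu; apply: arc_asym xu.
  by have [_] := below u bu; apply; [exact: xu|].
have az : a != z.
  by apply: contraTneq (Ta b ba) => az; apply: arc_asym; rewrite az Tz // -az.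
have -> : #|V| = #|connect next_twin b|.+2.
  rewrite -cardsT; have -> : [set: V] = a |: (z |: [set x | connect next_twin b x]).
    by apply/setP => v; rewrite !inE cover.
  have notK x : [set x] \in mc T -> x \notin [set x | connect next_twin b x].
    by rewrite [x \in _]inE; apply: contraTN => /single.
  rewrite !cardsU1 in_setU1 (negbTE az) !notK // cardsE.
  by [].
by rewrite /= negbK.
Qed.

(** With [z] a sink and [y] a sink of the rest, the chain ending at [y] is numbered from its end,
    all others from their first vertex. A module [[set a; b]] inside [X] needs an even number at
    [b], but [b] has number 1 unless [single_chain] applies. *)
Lemma tight_transversal_exists : ~ (transitive (tarc T) /\ ~~ odd #|V|) ->
  exists2 X, tight_transversal T X & #|X| <= comodular_index T.
Proof.
move=> notT.
pose last2 y z := [&& [set z] \in mc T, y != z, [forall v, (v != z) ==> T v z]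
  & [forall v, (v != z) && (v != y) ==> T v y]].
have last2P y z : last2 y z -> [/\ [set z] \in mc T, y != z,
    forall v, v != z -> T v z & forall v, v != z -> v != y -> T v y].
  case/and4P=> mz yz /forallP Tz /forallP Ty; split=> // v; first exact/implyP.
  by move=> vz vy; move: (Ty v); rewrite vz vy.
have finish (Y : pred V) : (forall x y, next_twin x y -> Y x = Y y) ->
    (forall x y z, last2 y z -> Y x = connect next_twin x y) ->
    (forall x, Y x -> exists y z, last2 y z) ->
    exists2 X, tight_transversal T X & #|X| <= comodular_index T.
  move=> Yc Y1 Y2; have exa := alternating_exact Yc.
  have priv x : x \in alternating_transversal Y -> exists2 F, F \in mc T & x \in F.
    by case/(alternating_packing Yc) => F; rewrite inE => /andP[mF _] xF; exists F.
  exists (alternating_transversal Y); last exact: card_alternating.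
  split=> // N nN; apply/negP => NX.
  have [a [b [c [e [ma NE ba [ae be ca cb [mbc nbc]]]]]]] :=
    module_in_exact_transversal exa priv nN NX.
  have bN : b \in N by rewrite NE set22.
  have := alternating_twin Y mbc _ (set21 b c).
  rewrite (subsetP NX _ bN) /twin nbc cards2 (eq_sym b) cb => /(_ isT)/esym.
  rewrite /rank; case: e ae be => ae be.
    have Ta v : v != a -> T a v by move/ae->.
    have Tb v : v != a -> v != b -> T b v by move=> va vb; rewrite be.
    case: ifP => Yb ev.
      have [y [z yz]] := Y2 b Yb; have [mz ny Tz Ty] := last2P _ _ yz.
      apply: notT; apply: (single_chain ma mz ba Ta Tb Tz Ty) => //.
      by rewrite -(Y1 _ _ _ yz).
    have [w wb] := even_connect_next ev.
    have Twb := next_twin_arc wb.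
    have [wa|wa] := eqVneq w a.
      by have [] := next_twin_singletons wb; rewrite wa ma.
    by have := arc_asym Twb; rewrite Tb // arc_neq.
  (* When [a] is a sink, [b] ends its chain, so its number is odd. *)
  have lba : last2 b a.
    rewrite /last2 ma ba /=; apply/andP; split.
      by apply/forallP => v; apply/implyP => va; rewrite (@arcC _ T a v) ?ae // eq_sym.
    apply/forallP => v; apply/implyP => /andP[va vb].
    by rewrite (@arcC _ T b v) ?be // eq_sym.
  rewrite (Y1 b _ _ lba) connect0 => ev.
  have [w bw] := even_connect_next ev.
  have [wa|wa] := eqVneq w a.
    by have [_] := next_twin_singletons bw; rewrite wa ma.
  have := next_twin_arc bw; rewrite be // eq_sym.
  exact: arc_neq (next_twin_arc bw).
have [/existsP[y /existsP[z yz]]|/existsPn none] :=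
    boolP [exists y, exists z, last2 y z].
  have [mz ny Tz Ty] := last2P _ _ yz.
  apply: (finish (fun x => connect next_twin x y)).
  - move=> x x' xx'; rewrite (connect_fun next_twin_fun y xx').
    have [yx|//] := eqVneq y x; subst x.
    have Tyx := next_twin_arc xx'.
    have [xz|xz] := eqVneq x' z.
      by have [_] := next_twin_singletons xx'; rewrite xz mz.
    by have := arc_asym Tyx; rewrite Ty // eq_sym arc_neq.
  - move=> x y' z' yz'; have [mz' ny' Tz' Ty'] := last2P _ _ yz'.
    have zz : z' = z.
      by apply: contraTeq isT => zz; have := arc_asym (Tz _ zz); rewrite Tz' // eq_sym.
    subst z'; suff -> : y' = y by [].
    apply: contraTeq isT => yy.
    by have := arc_asym (Ty _ ny' yy); rewrite Ty' // eq_sym.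
  by exists y, z.
apply: (finish xpred0) => // x y z yz.
by have /existsPn/(_ z) := none y; rewrite yz.
Qed.

Lemma indecomposable_inversion_exists : ~ (transitive (tarc T) /\ ~~ odd #|V|) ->
  exists X, indecomposable_inversion T X.
Proof.
move=> /tight_transversal_exists[X tX cX]; have [H1 _ _] := tX.
have [iX|dX] := boolP (indecomposable (Inv T X)); first by exists X.
case: (inversion_decomposable V5 tX dX).
  move=> [a [_ [_ [e [_ ma mA [_ _ _ _ [ae _]]]]]]].
  exact: endpoint_inversion ma mA ae.
move=> [F0 [_ [x1 [d [_ [mF F1 nF FE _]]]]]].
exact: (twin_complement_inversion V5 mF F1 nF FE).
Qed.

End TwinChains.

(** * The index *)

Section Index.

Variables (V : finType) (T : tournament V).
Implicit Types (E F N R S X : {set V}).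

(** When [X] does not overlap [N], the arcs between an outside vertex and [N] are all reversed or
    all kept. *)
Lemma inversion_module X N : module T N ->
  [|| X :&: N == set0, X :\: N == set0 | N :\: X == set0] -> module (Inv T X) N.
Proof.
move=> /moduleP mN h; apply/moduleP => x y v xN yN vN; rewrite /= /inv_arc.
case/or3P: h => [/eqP/setP h|/eqP/setP h|/eqP/setP h].
- have NX z : z \in N -> z \in X = false.
    by move=> zN; have := h z; rewrite !inE zN andbT.
  by rewrite (NX _ xN) (NX _ yN) andbF; apply: mN.
- have := h v; rewrite !inE vN /= => ->; exact: mN.
have NX z : z \in N -> z \in X.
  by move=> zN; have := h z; rewrite !inE zN andbT => /negbFE.
rewrite (NX _ xN) (NX _ yN) andbT; case: ifP => _; last exact: mN.
have mN' : module T N by apply/moduleP.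
exact: module_out mN' xN yN vN.
Qed.

Lemma indecomposable_overlap X N : indecomposable (Inv T X) ->
  N \in nontrivial_modules T -> overlap X N.
Proof.
move=> iX nN; apply: contraTT iX; rewrite /overlap !negb_and !negbK => h.
apply/negP => /indecomposableP/setP/(_ N); rewrite in_set0.
move: nN; rewrite !in_nontrivial => /andP[mN ->].
by rewrite inversion_module.
Qed.

(** Every co-module contains a minimal one, hence a point of [S]; disjoint co-modules receive
    distinct points. *)
Lemma transversal_ge S : transversal_of (mc T) S -> comodular_index T <= #|S|.
Proof.
move=> /forall_inP tS; apply/bigmax_leqP => P /andP[/subsetP sP /trivIsetP dP].
pose h F := [pick x in F :&: S].
have hP F : F \in P -> exists2 x, h F = Some x & (x \in F) && (x \in S).
  move=> /sP/mc_sub[E mE /subsetP sE]; rewrite /h.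
  have /set0Pn[y] := tS _ mE; rewrite inE => /andP[yE yS].
  case: pickP => [x|/(_ y)]; first by rewrite inE => xFS; exists x.
  by rewrite inE yS sE.
rewrite -(@card_in_imset _ _ h P).
  apply: leq_trans (leq_imset_card (@Some V) S).
  apply/subset_leq_card/subsetP => _ /imsetP[F /hP[x -> /andP[_ xS]] ->].
  exact: imset_f.
move=> E F EP FP hEF; apply: contraTeq isT => EF.
have [x hx /andP[xE _]] := hP _ EP; have [y hy /andP[yF _]] := hP _ FP.
have xy : x = y by move: hEF; rewrite hx hy => -[].
have := dP _ _ EP FP EF; rewrite disjoints_subset => /subsetP/(_ x xE).
by rewrite inE xy yF.
Qed.

Lemma indecomposable_transversal X : indecomposable (Inv T X) ->
  transversal_of (mc T) X.
Proof.
move=> iX; apply/forall_inP => F /mc_comodule; rewrite inE.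
move=> /orP[] /(indecomposable_overlap iX)/and3P[h1 h2 _].
  by rewrite setIC.
by move: h2; rewrite setDE setCK setIC.
Qed.

End Index.

Theorem theorem4p1 (V : finType) (T : tournament V)
    (order_ge5 : 5 <= #|V|)
    (not_even_transitive : ~ (transitive (tarc T) /\ ~~ odd #|V|)) :
  (exists2 X : {set V}, X \in tr T & indecomposable (Inv T X)) /\
  decomposability_subtournament_index T = comodular_index T.
Proof.
have [X [exX cX iX]] := indecomposable_inversion_exists order_ge5 not_even_transitive.
have tX := indecomposable_transversal iX.
split.
  exists X => //; rewrite inE; apply/and3P; split.
  - rewrite /exact_transversal_of tX; apply/forall_inP => F /exX[x ->].
    by rewrite cards1.
  - rewrite /minimum_transversal_of tX; apply/forallP => S; apply/implyP => tS.
    exact: leq_trans cX (transversal_ge tS).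
  by apply/forall_inP => N; apply: indecomposable_overlap.
rewrite /decomposability_subtournament_index.
(* The minimum is taken here with default [X], while the index has default [[set: V]]; unfolding
   shows that its [pick] succeeds, so that default is never returned. *)
have [minX iM leM] :=
  @arg_minnP _ X (fun X => indecomposable (Inv T X)) (fun X => #|X|) iX.
rewrite /arg_min /extremum; case: pickP => [Y /andP[iY /forallP leY]|/(_ minX)] /=.
  apply/eqP; rewrite eqn_leq transversal_ge ?indecomposable_transversal // andbT.
  by apply: leq_trans cX; have := leY X; rewrite iX.
by rewrite iM /= => /negbT/forallPn[Y]; rewrite negb_imply => /andP[/leM->].
Qed.
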